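(* Let $\delta\in(0,1)$. Let $G$ be a Gaussian process on $[0,1]$ such that $G-\mathbb{E}G$ is stationary with Matérn spectral density $$\hat K(\omega)=\frac{\sqrt{4\pi}\,\Gamma(\nu+1/2)}{\Gamma(\nu)}\sigma^2\rho^{-2\nu}\left(\frac1{\rho^2}+\omega^2\right)^{-(\nu+1/2)},$$ where $\nu\in(0,\infty)$ is known and $(\sigma,\rho)\in\Omega$ is unknown. Suppose one realization of $G$ is observed at the regular points $i/n$, $i=1,\dots,n$, and consider the plug-in GLRT $\tilde T_{GLRT}$ described in the context, built with $\tilde\rho_m=\sup\{\rho:(\sigma,\rho)\in\Omega\}$ and an estimator $\tilde\sigma_m$ that is consistent in the sense that $|\sigma\rho^{-\nu}-\tilde\sigma_m\tilde\rho_m^{-\nu}|\to0$ in probability as $m\to\infty$, where $m=\lfloor\alpha n\rfloor$. Then there are a finite scalar $C$, $n_0\in\mathbb{N}$, a non-negative sequence $\tau_m$ with $\lim_{m\to\infty}\tau_m=0$, and a threshold level $R_{n,\delta}>0$ such that for any $n\ge n_0$, $$\varphi_n(\tilde T_{GLRT})\le\delta+2\tau_m$$ whenever $$|b|\ge Cn^{-\nu}\sqrt{C_K\left(1+\frac1\nu\right)\log\left(\frac{n(1-2\alpha)}{\delta}\right)}.$$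
   Context: Observations: $\boldsymbol X=(X_1,\dots,X_n)^\top$ with $X_k=G(k/n)$, with covariance matrix $\Sigma_n=[K((r-s)/n,\eta)]_{r,s=1}^n$, where $\eta=(\sigma,\rho)$ and $K(\cdot,\eta)$ is the covariance function with the Matérn spectral density $\hat K(\omega)=\frac{\sqrt{4\pi}\,\Gamma(\nu+1/2)}{\Gamma(\nu)}\sigma^2\rho^{-2\nu}\left(\frac1{\rho^2}+\omega^2\right)^{-(\nu+1/2)}$ (Fourier transform convention $\hat K(\omega)=\int K(t)e^{-j\omega t}dt$, where $j^2=-1$). $C_K:=\sup_{\omega\in\mathbb{R}}|\hat K(\omega)(1+\omega^2)^{\nu+1/2}|$. The parameter set $\Omega\subset(0,\infty)^2$ is a compact set. Testing problem: fix $\alpha\in(0,1/2)$; the set of possible change points $\mathcal{C}_{n,\alpha}\subseteq\{k:\alpha n\le k\le(1-\alpha)n\}$. For $t\in\mathcal{C}_{n,\alpha}$ let $\zeta_t\in\mathbb{R}^n$ have $\zeta_t(k)=-1$ for $k\le t$ and $+1$ for $k>t$. The null hypothesis is $\mathbb{H}_0:\mathbb{E}\boldsymbol X=0$; the alternative with change point $t$ and jump $b\ne0$ is $\mathbb{H}_{1,t}:\mathbb{E}\boldsymbol X=\frac b2\zeta_t$ (same covariance). Plug-in GLRT (generalized likelihood ratio test with estimated covariance): the controlled (burn-in) samples are $\boldsymbol X_{\mathcal{B}}=\{X_k:k\le\alpha n\}$, with $m=\lfloor\alpha n\rfloor$. The range parameter is fixed deterministically at $\tilde\rho_m=\sup\{\rho:(\sigma,\rho)\in\Omega\}$;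 $\tilde\sigma_m$ is computed from $\boldsymbol X_{\mathcal{B}}$ by any procedure which is consistent in the sense that $|\sigma\rho^{-\nu}-\tilde\sigma_m\tilde\rho_m^{-\nu}|\to0$ in probability as $m\to\infty$ (convergence in probability under the law of the data). Put $\tilde\eta_m=(\tilde\sigma_m,\tilde\rho_m)$, $\tilde\Sigma_n=[K((r-s)/n,\tilde\eta_m)]_{r,s=1}^n$, and $$\tilde T_{GLRT}=\mathbf{1}\left(\max_{t\in\mathcal{C}_{n,\alpha}}\left|\frac{\zeta_t^\top\tilde\Sigma_n^{-1}\boldsymbol X}{\sqrt{\zeta_t^\top\tilde\Sigma_n^{-1}\zeta_t}}\right|^2\ge R_{n,\delta}\right),$$ where $\mathbf{1}(\cdot)$ is the indicator function. For a test $T\in\{0,1\}$, $\varphi_n(T)=\mathbb{P}(T=1\mid\mathbb{H}_0)+\max_{t\in\mathcal{C}_{n,\alpha}}\mathbb{P}(T=0\mid\mathbb{H}_{1,t})$, where under $\mathbb{H}_{1,t}$ the jump size is $b$. *)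

(* Defs.v *)
From HB Require Import structures.
From mathcomp Require Import all_boot all_order all_algebra.
From mathcomp Require Import all_classical all_reals all_analysis.

Set Implicit Arguments.
Unset Strict Implicit.
Unset Printing Implicit Defensive.

Import Order.TTheory GRing.Theory Num.Theory.
Import numFieldNormedType.Exports.

Local Open Scope classical_set_scope.
Local Open Scope ring_scope.

Definition gamma_fun (R : realType) (x : R) : R :=
  \int[lebesgue_measure]_(u in `]0, +oo[) (u `^ (x - 1) * expR (- u)).

(* A parameter is a pair [eta = (sigma, rho)]. *)
Definition matern_density (R : realType) (nu : R) (eta : R * R) (w : R) : R :=
  Num.sqrt (4 * pi) * gamma_fun (nu + 2^-1) / gamma_fun nu *
  eta.1 ^+ 2 * eta.2 `^ (- (2 * nu)) *
  ((eta.2 ^+ 2)^-1 + w ^+ 2) `^ (- (nu + 2^-1)).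

(* The covariance function with spectral density [S], for the convention
   [S w = \int K(t) exp(-jwt) dt], that is
   [K(t) = (2 pi)^-1 \int S(w) exp(jwt) dw].  Only even densities [S] are used,
   for which the imaginary part (the sine integral) vanishes. *)
Definition spectral_cov (R : realType) (S : R -> R) (t : R) : R :=
  (2 * pi)^-1 * \int[lebesgue_measure]_(w in setT) (S w * cos (w * t)).

Definition matern_cov (R : realType) (nu : R) (eta : R * R) : R -> R :=
  spectral_cov (matern_density nu eta).

Definition C_K (R : realType) (nu : R) (eta : R * R) : R :=
  sup [set `|matern_density nu eta w * (1 + w ^+ 2) `^ (nu + 2^-1)|
      | w in [set: R]].

Definition rho_max (R : realType) (Om : set (R * R)) : R :=
  sup [set eta.2 | eta in Om].

(* A Gaussian law, the degenerate ones included.  The case [s = 0] is treated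
   apart because [normal_prob m 0] is not a Dirac mass. *)
Definition gaussian_law (R : realType) d (T : measurableType d)
    (P : probability T R) (X : T -> R) : Prop :=
  exists m s : R, 0 <= s /\
    forall A : set R, measurable A ->
      P (X @^-1` A) = if s == 0 then \d_m A else normal_prob m s A.

Definition gaussian_process (R : realType) d (T : measurableType d)
    (P : probability T R) (G : R -> {mfun T >-> R}) : Prop :=
  forall (N : nat) (t : 'I_N -> R) (a : 'I_N -> R),
    (forall i, 0 <= t i <= 1) ->
    gaussian_law P (fun w => \sum_(i < N) a i * G (t i) w).

(* [G - E G] is stationary on [0, 1] with spectral density [S]. *)
Definition has_spectral_density (R : realType) d (T : measurableType d)
    (P : probability T R) (G : R -> {mfun T >-> R}) (S : R -> R) : Prop :=
  forall s t : R, 0 <= s <= 1 -> 0 <= t <= 1 ->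
    covariance P (G s) (G t) = (spectral_cov S (s - t))%:E.

(* Data are indexed from 1: [x k] is the observation [X_k] for [1 <= k <= n]. *)
Definition obs (R : realType) d (T : measurableType d)
    (G : R -> {mfun T >-> R}) (n : nat) (w : T) (k : nat) : R :=
  G (k%:R / n%:R) w.

Definition sample (R : realType) (n : nat) (x : nat -> R) : 'cV[R]_n :=
  \col_(k < n) x k.+1.

Definition zeta (R : realType) (t k : nat) : R :=
  if (k <= t)%N then -1 else 1.

Definition cov_mx (R : realType) (nu : R) (eta : R * R) (n : nat) : 'M[R]_n :=
  \matrix_(r < n, s < n) matern_cov nu eta ((r.+1%:R - s.+1%:R) / n%:R).

(* [H1 t]: there is a change of mean at [t]. *)
Inductive hypothesis := H0 | H1 of nat.

Definition hyp_mean (R : realType) (b : R) (h : hypothesis) (k : nat) : R :=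
  match h with H0 => 0 | H1 t => b / 2 * zeta R t k end.

Definition admissible (CP : nat -> pred nat) (n : nat) (h : hypothesis) : Prop :=
  match h with H0 => True | H1 t => CP n t end.

Definition data_law (R : realType) (nu : R) (eta : R * R) (b : R)
    (n : nat) (h : hypothesis) d (T : measurableType d)
    (P : probability T R) (G : R -> {mfun T >-> R}) : Prop :=
  [/\ gaussian_process P G,
      has_spectral_density P G (matern_density nu eta) &
      forall k, (1 <= k <= n)%N -> ('E_P[G (k%:R / n%:R)%R] = (hyp_mean b h k)%:E)%E].

Definition burnin_size (R : realType) (alpha : R) (n : nat) : nat :=
  Num.truncn (alpha * n%:R).

Definition burnin (R : realType) (alpha : R) (n : nat) (x : nat -> R) :
    (burnin_size alpha n).-tuple R :=
  [tuple x k.+1 | k < burnin_size alpha n].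

(* The maximum of squares is nonnegative, so [0] is a neutral start value. *)
Definition glrt (R : realType) (nu : R) (eta : R * R) (n : nat)
    (C : pred nat) (thr : R) (x : nat -> R) : bool :=
  let S := invmx (cov_mx nu eta n) in
  let X := sample n x in
  let z t := sample n (zeta R t) in
  thr <= \big[Num.max/0]_(t < n.+1 | C t)
    `|((z t)^T *m S *m X) 0 0 / Num.sqrt (((z t)^T *m S *m z t) 0 0)| ^+ 2.

(* [sigma_hat n] is the estimator of [sigma] from the burn-in sample of size
   [burnin_size alpha n]. *)
Definition plugin_glrt (R : realType) (nu alpha : R) (Om : set (R * R))
    (CP : nat -> pred nat)
    (sigma_hat : forall n, (burnin_size alpha n).-tuple R -> R)
    (thr : nat -> R) (n : nat) (x : nat -> R) : bool :=
  glrt nu (sigma_hat n (burnin alpha n x), rho_max Om) n (CP n) (thr n) x.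

(* Convergence in probability to 0 of
   [sigma rho^-nu - sigma_hat rho_max^-nu], whichever of the hypotheses
   generates the data at each sample size. *)
Definition consistent (R : realType) (nu alpha : R) (Om : set (R * R))
    (CP : nat -> pred nat)
    (sigma_hat : forall n, (burnin_size alpha n).-tuple R -> R)
    (eta : R * R) d (T : measurableType d)
    (P : nat -> hypothesis -> probability T R)
    (G : R -> {mfun T >-> R}) : Prop :=
  forall h : nat -> hypothesis, (forall n, admissible CP n (h n)) ->
  forall eps : R, 0 < eps ->
    (fun n => P n (h n) [set w | eps <
        `|eta.1 * eta.2 `^ (- nu) -
          sigma_hat n (burnin alpha n (obs G n w)) * rho_max Om `^ (- nu)|])
      @ \oo --> 0%E.

Definition risk (R : realType) (CP : nat -> pred nat) d (T : measurableType d)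
    (P : nat -> hypothesis -> probability T R) (G : R -> {mfun T >-> R})
    (n : nat) (test : (nat -> R) -> bool) : R :=
  fine (P n H0 [set w | test (obs G n w)]) +
  \big[Num.max/0]_(t < n.+1 | CP n t)
    fine (P n (H1 t) [set w | ~~ test (obs G n w)]).

(* Main.v *)
Require Import Defs.
From HB Require Import structures.
From mathcomp Require Import all_boot all_order all_algebra.
From mathcomp Require Import all_classical all_reals all_analysis.
From mathcomp Require Import measurable_realfun.
From mathcomp Require Import complex ring lra.

Import Order.TTheory GRing.Theory Num.Theory.
Import numFieldNormedType.Exports.

Local Open Scope classical_set_scope.
Local Open Scope ring_scope.

Set Implicit Arguments.
Unset Strict Implicit.
Unset Printing Implicit Defensive.

(** Write [rho] for the largest range in the parameter set and [M] for the
    covariance matrix with parameters [(1, rho)].  Changing the plug-in scale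
    multiplies the plug-in covariance by a scalar, so the test compares
    [thr * sigma_hat^2] with the squares of the statistics
    [Y_t = zeta_t^T M^-1 X / sqrt v_t], where [v_t = zeta_t^T M^-1 zeta_t]
    ([glrtE]).  These are linear in the data with deterministic weights.  If
    [(sigma, rho_true)] are the true parameters, consistency places
    [sigma_hat], with high probability, within half of
    [matched_scale = sigma * (rho / rho_true)^nu] from that value ([not_bad]).

    Noise.  The densities with parameters [(sigma, rho_true)] and
    [(matched_scale, rho)] share their high-frequency behaviour, and the second
    one is pointwise larger because [rho] overestimates the range
    ([matern_density_le]).  Quadratic forms of the covariance matrices are
    integrals of the density against squared moduli of trigonometric polynomials
    ([qform_cov]), hence [Var Y_t <= matched_scale^2]
    ([qform_glrt_weight_le]).  A Gaussian tail bound and a union bound over the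
    at most [n + 1] change points control the false alarms
    ([false_alarm_le]), with a threshold of order [log n].

    Signal.  Under a change at [t] the mean of [Y_t] is [b / 2 * sqrt v_t].  The
    rate [n^-nu] comes from [v_t >= c * n^(2 nu)] ([signal_energy_ge]): by
    Cauchy-Schwarz, [v_t >= (a^T zeta_t)^2 / (a^T M a)] for every vector [a]; take
    for [a] the finite-difference coefficients of order [p > nu] placed at
    [t, ..., t + p].  Of these points, the first one alone precedes the jump, so
    [a^T zeta_t = - 2], whereas [a^T M a] is the integral of the density against
    [(2 - 2 cos (w / n))^p].  The difference operator suppresses the frequencies
    below [n], and the tail of the density beyond [n] has mass of order
    [n^(- 2 nu)] ([qform_stencil_le]).

    Uniformity.  The constants depend on the parameters only through bounds on
    the range, which are available by compactness ([range_ge_pos],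
    [range_le_rho_max]); [C_K] dominates [(sigma * rho_true^-nu)^2] up to such
    a constant ([C_K_ge]).  Consistency along every selection of hypotheses
    is upgraded to consistency uniform over hypotheses
    ([uniform_over_hypotheses]), which yields [tau]. *)

(** * Integrals dominated by a bounded antiderivative, and the Gamma function *)

Section integrals.
Variable R : realType.
Local Notation mu := (@lebesgue_measure R).
Implicit Types (f F : R -> R).

Lemma Rintegral_gt0 (D : set R) f (a b c : R) : measurable D ->
  mu.-integrable D (EFin \o f) -> (forall x, D x -> 0 <= f x) ->
  a < b -> 0 < c -> (forall x, a < x < b -> D x /\ c <= f x) ->
  0 < \int[mu]_(x in D) f x.
Proof.
move=> mD fi f0 ab c0 cf.
have sub : `]a, b[%classic `<=` D.
  by move=> x /=; rewrite in_itv/= => /cf[].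
have : ((c * (b - a))%:E <= \int[mu]_(x in D) (f x)%:E)%E.
  apply: (@le_trans _ _ (\int[mu]_(x in `]a, b[) (f x)%:E)%E); last first.
    by apply: ge0_subset_integral => //; exact: (measurable_int mu).
  apply: (@le_trans _ _ (\int[mu]_(x in `]a, b[) c%:E)%E).
    by rewrite integral_cst//= lebesgue_measure_itv/= lte_fin ab -EFinD -EFinM.
  apply: ge0_le_integral => //=.
  - by move=> x _; rewrite lee_fin ltW.
  - apply: (measurable_funS mD sub).
    exact: (measurable_int mu).
  - by move=> x; rewrite in_itv/= lee_fin => /cf[].
have fin : (\int[mu]_(x in D) (f x)%:E \is a fin_num)%E.
  exact: integrable_fin_num.
rewrite -(fineK fin) lee_fin; apply: lt_le_trans.
by rewrite mulr_gt0// subr_gt0.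
Qed.

(** Exhausting the half-line by compact intervals reduces the bound to the
    oscillation of [F], so neither [f] nor [F] needs a limit at the ends. *)
Lemma ge0_integral_antiderivative_le f F (a l : R) :
  (forall x, a < x -> 0 <= f x) ->
  (forall x : R, a < x -> {for x, continuous f}) ->
  (forall x : R, a < x -> is_derive x 1 F (f x)) ->
  (forall x, a < x -> 0 <= F x <= l) ->
  (\int[mu]_(x in `]a, +oo[) (f x)%:E <= l%:E)%E.
Proof.
move=> f0 cf dF Fl.
pose lo k : R := a + (k.+2%:R)^-1; pose hi k : R := a + k.+2%:R.
pose D k := `[lo k, hi k]%classic.
have alo k : a < lo k by rewrite ltrDl invr_gt0.
have lohi k : lo k < hi k.
  by rewrite ltrD2l (@lt_trans _ _ 1) ?ltr1n// invf_lt1 ?ltr1n.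
have Da k x : D k x -> a < x.
  by rewrite /D/= in_itv/= => /andP[+ _]; exact: lt_le_trans.
have DE : `]a, +oo[%classic = \bigcup_k D k.
  apply/seteqP; split => x /=; last first.
    by move=> [k _ /Da]; rewrite in_itv/= => ->.
  rewrite in_itv/= andbT => ax.
  have xa : 0 < x - a by rewrite subr_gt0.
  pose k := (Num.truncn (x - a) + Num.truncn (x - a)^-1)%N.
  exists k => //=; rewrite /D /= in_itv/= /lo /hi; apply/andP; split.
    rewrite -lerBrDl invf_ple ?posrE//.
    by rewrite (le_trans (ltW (truncnS_gt _)))// ler_nat ltnS leqW// leq_addl.
  rewrite -lerBlDl.
  by rewrite (le_trans (ltW (truncnS_gt _)))// ler_nat ltnS leqW// leq_addr.
have mf : measurable_fun `]a, +oo[ f.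
  apply: open_continuous_measurable_fun => //.
  by move=> x; rewrite inE/= in_itv/= andbT => /cf.
have ndD : nondecreasing_seq D.
  move=> i j ij; rewrite subsetEset => x; rewrite /D /= !in_itv/= /lo /hi.
  move=> /andP[lx xh]; apply/andP; split.
    by apply: le_trans lx; rewrite lerD2l lef_pV2 ?posrE// ler_nat.
  by apply: (le_trans xh); rewrite lerD2l ler_nat.
have mDf k : measurable_fun (D k) (EFin \o f).
  apply/measurable_EFinP; apply: measurable_funS mf => //.
  by move=> x /Da; rewrite /= in_itv/= => ->.
have : (\int[mu]_(x in D k) (f x)%:E @[k --> \oo] -->
   \int[mu]_(x in `]a, +oo[) (f x)%:E)%E.
  rewrite DE.
  apply: ge0_nondecreasing_set_cvg_integral => //.
    by move=> i; rewrite /D.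
  by move=> i x /Da ax; rewrite lee_fin f0.
move=> H; rewrite -(cvg_lim _ H)//; apply: lime_le.
  by apply/cvg_ex; eexists; exact: H.
apply: nearW => k.
have cF x : a < x -> F y @[y --> x] --> F x.
  by move=> /dF[/derivable1_diffP/differentiable_continuous + _]; apply.
rewrite /D (@continuous_FTC2 _ f F)//.
- rewrite -EFinB lee_fin lerBlDr.
  have /andP[F0 _] := Fl _ (alo k).
  have /andP[_ Fh] := Fl _ (lt_trans (alo k) (lohi k)).
  by rewrite (le_trans Fh)// lerDl.
- apply: continuous_in_subspaceT => x; rewrite inE => /Da.
  exact: cf.
- split.
  + move=> x; rewrite in_itv/= => /andP[lx _].
    by case: (dF x (lt_trans (alo k) lx)).
  + exact/cvg_at_right_filter/cF.
  + exact/cvg_at_left_filter/cF/(lt_trans (alo k) (lohi k)).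
- move=> x; rewrite in_itv/= => /andP[lx _]; rewrite derive1E.
  by case: (dF x (lt_trans (alo k) lx)).
Qed.

End integrals.

Section gamma.
Variable R : realType.
Local Notation mu := (@lebesgue_measure R).
Implicit Types (nu u : R).

Lemma is_derive_powR_comp (f : R -> R) (x a df : R) : 0 < f x ->
  is_derive x 1 f df -> is_derive x 1 (fun y => f y `^ a) (a * f x `^ (a - 1) * df).
Proof.
move=> fx0 dfx.
have H := is_derive1_powR a fx0.
have := @is_derive1_comp R (fun y => y `^ a) f x _ _ H dfx.
by rewrite /comp.
Qed.

Lemma continuous_powR (a x : R) : 0 < x -> {for x, continuous (fun y : R => y `^ a)}.
Proof.
move=> /(is_derive1_powR a)[/derivable1_diffP/differentiable_continuous + _].
exact.
Qed.

Lemma expR_ge_expn (x : R) n : 0 <= x -> x ^+ n <= n`!%:R * expR x.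
Proof.
move=> x0; case: n => [|n].
  by rewrite fact0 expr0 mul1r -(expR0 R) ler_expR.
have := expR_ge1Dxn n x0.
rewrite -(ler_pM2l (_ : 0 < (n.+1)`!%:R)) ?ltr0n ?fact_gt0//.
apply: le_trans; rewrite mulrDr mulrCA divff ?mulr1 ?pnatr_eq0 -?lt0n ?fact_gt0//.
by rewrite lerDr.
Qed.

(** The function [u^(nu-1) (1+u)^-(nu+1)] has the bounded antiderivative
    [(u/(1+u))^nu / nu]; it dominates the Gamma integrand both at [0] and at
    infinity. *)
Lemma gamma_integrable nu : 0 < nu ->
  mu.-integrable `]0, +oo[%classic (fun u => (u `^ (nu - 1) * expR (- u))%:E).
Proof.
move=> nu0.
(* [(1 + u)^(nu + 1) <= (1 + u)^N <= N! exp (1 + u)]. *)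
pose N := (Num.truncn (nu + 1)).+1.
pose c : R := N`!%:R * expR 1.
pose g (u : R) : R := u `^ (nu - 1) * (1 + u) `^ (- (nu + 1)).
pose F (u : R) : R := nu^-1 * (u `^ nu * (1 + u) `^ (- nu)).
have dF (x : R) : 0 < x -> is_derive x 1 F (g x).
  move=> x0.
  have x1 : 0 < 1 + x by rewrite addr_gt0.
  have x10 : 1 + x != 0 by rewrite gt_eqF.
  have d1 : is_derive x 1 (fun y : R => 1 + y) (1 : R).
    have := is_deriveD (is_derive_cst (1 : R) x (1 : R)) (is_derive_id x (1 : R)).
    by rewrite add0r.
  have d2 := is_derive_powR_comp (- nu) x1 d1.
  have d3 := is_derive1_powR nu x0.
  have d4 := is_deriveZ nu^-1 (is_deriveM d3 d2).
  apply: (is_derive_eq d4).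
  rewrite /GRing.scale/= /g.
  have -> : x `^ nu = x * x `^ (nu - 1) by rewrite mulr_powRB1 ?ltW.
  have -> : - nu - 1 = - (nu + 1) by ring.
  have -> : (1 + x) `^ (- nu) = (1 + x) * (1 + x) `^ (- (nu + 1)).
    rewrite -[X in X * _]powRr1 ?ltW// -powRD ?x10 ?implybT//.
    by congr (_ `^ _); ring.
  by field; rewrite gt_eqF.
have gle : (\int[mu]_(x in `]0%R, +oo[) (g x)%:E <= (nu^-1)%:E)%E.
  apply: (@ge0_integral_antiderivative_le _ g F).
  - by move=> x x0; rewrite mulr_ge0 ?powR_ge0.
  - move=> x x0.
    apply: cvgM; first exact: continuous_powR.
    apply: (@continuous_comp _ _ _ (fun y : R => 1 + y) (fun y : R => y `^ (- (nu + 1)))).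
      by apply: cvgD; [exact: cvg_cst|exact: cvg_id].
    by apply: continuous_powR; rewrite addr_gt0.
  - move=> x x0.
    have x1 : 0 < 1 + x by rewrite addr_gt0.
    rewrite mulr_ge0 ?mulr_ge0 ?invr_ge0 ?powR_ge0 ?(ltW nu0)//=.
    rewrite -[leRHS]mulr1 ler_pM2l ?invr_gt0//.
    rewrite powRN ler_pdivrMr ?powR_gt0// mul1r ge0_ler_powR ?nnegrE ?ltW//.
    by rewrite ltrDr.
have mX a : measurable_fun `](0 : R), +oo[ (fun u : R => (1 + u) `^ a).
  apply: (measurableT_comp (measurable_powR a)).
  exact: measurable_funD.
have mg : measurable_fun `](0 : R), +oo[ g.
  apply: measurable_funM; last exact: mX.
  exact: (measurable_funTS (measurable_powR _)).
have gi : mu.-integrable `]0, +oo[%classic (EFin \o g).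
  apply/integrableP; split; first exact/measurable_EFinP.
  apply: (le_lt_trans _ (ltry nu^-1)).
  apply: le_trans gle; rewrite le_eqVlt; apply/orP; left; apply/eqP.
  apply: eq_integral => x _ /=.
  by rewrite ger0_norm// mulr_ge0 ?powR_ge0.
apply: (@le_integrable _ _ _ mu _ _ _ (fun u => c%:E * (EFin \o g) u)%E) => //.
- apply/measurable_EFinP/measurable_funM.
    exact: (measurable_funTS (measurable_powR _)).
  by apply: measurableT_comp => //; exact: measurable_funN.
- move=> u; rewrite /= in_itv/= andbT => u0; rewrite lee_fin.
  have u1 : 1 <= 1 + u by rewrite lerDl ltW.
  have u10 : 0 <= 1 + u by apply: le_trans u1.
  rewrite !ger0_norm ?mulr_ge0 ?powR_ge0 ?expR_ge0//.
  rewrite /g mulrCA; apply: ler_wpM2l; first exact: powR_ge0.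
  rewrite powRN ler_pdivlMr ?powR_gt0 1?(lt_le_trans _ u1)//.
  rewrite expRN mulrC ler_pdivrMr ?expR_gt0// /c -mulrA -expRD.
  apply: le_trans (expR_ge_expn N u10).
  by rewrite -powR_mulrn// ler_powR// ltW// truncnS_gt.
- exact: integrableZl.
Qed.

(** A real-valued integral is [0] by convention when the extended one is
    infinite, so positivity rests on integrability. *)
Lemma gamma_fun_gt0 nu : 0 < nu -> 0 < gamma_fun nu.
Proof.
move=> nu0; rewrite /gamma_fun.
pose c : R := Num.min (1 `^ (nu - 1)) (2 `^ (nu - 1)) * expR (- 2).
apply: (@Rintegral_gt0 _ _ _ 1 2 c) => //.
- exact: gamma_integrable.
- by move=> x _; rewrite mulr_ge0 ?powR_ge0 ?expR_ge0.
- by rewrite ltr1n.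
- by rewrite mulr_gt0 ?expR_gt0// lt_min !powR_gt0.
- move=> x /andP[x1 x2]; have x0 : 0 < x by apply: lt_trans x1.
  split; first by rewrite /= in_itv/= x0.
  have min0 : 0 <= Num.min ((1 : R) `^ (nu - 1)) (2 `^ (nu - 1)).
    by rewrite le_min !powR_ge0.
  apply: ler_pM => //.
    have [n1|n1] := leP 0 (nu - 1).
      by rewrite ge_min ge0_ler_powR ?nnegrE// ltW.
    rewrite ge_min; apply/orP; right.
    rewrite -[nu - 1]opprK !(powRN _ (- (nu - 1))) lef_pV2 ?posrE ?powR_gt0//.
    by rewrite ge0_ler_powR ?nnegrE ?oppr_ge0 ?ltW.
  by rewrite ler_expR lerN2 ltW.
Qed.

End gamma.

(** * The Matern spectral density *)

Section tails.
Variable R : realType.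
Local Notation mu := (@lebesgue_measure R).
Variable nu : R.
Hypothesis nu0 : 0 < nu.

Lemma tail_integral_le (K a : R) : 0 <= K -> 0 < a ->
  (\int[mu]_(x in `]a, +oo[) (K * x `^ (- (2 * nu + 1)))%:E
    <= (K * a `^ (- (2 * nu)) / (2 * nu))%:E)%E.
Proof.
move=> K0 a0; have n20 : 0 < 2 * nu by rewrite mulr_gt0.
have x0 x : a < x -> 0 < x by apply: lt_trans.
pose F x := (K / (2 * nu)) * (a `^ (- (2 * nu)) - x `^ (- (2 * nu))).
have dF (x : R) : a < x -> is_derive x 1 F (K * x `^ (- (2 * nu + 1))).
  move=> /x0 xp.
  have d1 := is_derive1_powR (- (2 * nu)) xp.
  have d2 := is_deriveB (is_derive_cst (a `^ (- (2 * nu))) x (1 : R)) d1.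
  have d3 := is_deriveZ (K / (2 * nu)) d2.
  apply: (is_derive_eq d3); rewrite /GRing.scale/=.
  have -> : - (2 * nu) - 1 = - (2 * nu + 1) by ring.
  by field; rewrite gt_eqF.
apply: (@ge0_integral_antiderivative_le _ _ F).
- by move=> x _; rewrite mulr_ge0 ?powR_ge0.
- move=> x /x0 xp; apply: cvgM; first exact: cvg_cst.
  exact: continuous_powR.
- move=> x ax; have xp := x0 _ ax; rewrite /F.
  have Kn : 0 <= K / (2 * nu) by rewrite divr_ge0// ltW.
  rewrite (mulrAC K (a `^ _)).
  have xa : x `^ (- (2 * nu)) <= a `^ (- (2 * nu)).
    rewrite !powRN lef_pV2 ?posrE ?powR_gt0//.
    by rewrite ge0_ler_powR ?nnegrE ?ltW.
  rewrite mulr_ge0 ?subr_ge0//=.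
  by rewrite ler_wpM2l// gerBl powR_ge0.
Qed.

(** Cutting at [a = 1] gives the integrability of the spectral density, cutting
    at the Nyquist scale [a = n] the order of magnitude of finite
    differences. *)
Lemma even_integral_le (f : R -> R) (a B K : R) :
  0 < a -> 0 <= K -> (forall x, 0 <= f x) -> continuous f -> f =1 f \o -%R ->
  (forall x, 0 <= x <= a -> f x <= B) ->
  (forall x, a < x -> f x <= K * x `^ (- (2 * nu + 1))) ->
  (\int[mu]_x (f x)%:E
    <= (2 * (B * a + K * a `^ (- (2 * nu)) / (2 * nu)))%:E)%E.
Proof.
move=> a0 K0 f0 cf ef fB fK.
have mf : measurable_fun [set: R] f by exact: continuous_measurable_fun.
rewrite ge0_symfun_integralT// EFinM lee_pmul2l ?lte_fin//.
have -> : [set x : R | 0 <= x] = `[0, a]%classic `|` `]a, +oo[%classic.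
  apply/seteqP; split => x /=; rewrite !in_itv/= ?andbT.
    by move=> ->/=; case: leP => ?; [left|right].
  by case=> [/andP[]//|/ltW]; apply: le_trans; rewrite ltW.
rewrite ge0_integral_setU//=.
- rewrite EFinD; apply: leeD.
    apply: (@le_trans _ _ (\int[mu]_(x in `[0%R, a]) B%:E)%E).
      apply: ge0_le_integral => //=.
      + by move=> x _; rewrite lee_fin.
      + exact/measurable_EFinP/measurable_funTS.
    by rewrite integral_cst//= lebesgue_measure_itv/= lte_fin a0 -EFinD subr0 -EFinM.
  apply: le_trans (tail_integral_le K0 a0).
  apply: ge0_le_integral => //=.
  + by move=> x _; rewrite lee_fin.
  + exact/measurable_EFinP/measurable_funTS.
  + apply/measurable_EFinP; apply: measurable_funM => //.
    exact: (measurable_funTS (measurable_powR _)).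
  + by move=> x; rewrite in_itv/= andbT lee_fin => /fK.
- exact/measurable_EFinP/measurable_funTS.
- by move=> x _; rewrite lee_fin.
- apply/disj_setPS => x /= []; rewrite !in_itv/= andbT => /andP[_ xa].
  by rewrite ltNge xa.
Qed.

End tails.

Section density.
Variable R : realType.
Local Notation mu := (@lebesgue_measure R).
Variable nu : R.
Hypothesis nu0 : 0 < nu.
Implicit Types eta : R * R.

Definition matern_amp : R :=
  Num.sqrt (4 * pi) * gamma_fun (nu + 2^-1) / gamma_fun nu.

Lemma matern_amp_gt0 : 0 < matern_amp.
Proof.
rewrite /matern_amp divr_gt0 ?mulr_gt0 ?sqrtr_gt0 ?gamma_fun_gt0//.
  by rewrite mulr_gt0// pi_gt0.
by rewrite addr_gt0.
Qed.

(** All members of the family with the same value of [sigma^2 rho^(-2 nu)] are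
    asymptotically equivalent at high frequencies. *)
Definition microergodic eta : R := eta.1 ^+ 2 * eta.2 `^ (- (2 * nu)).

Lemma matern_densityE eta w : matern_density nu eta w =
  matern_amp * microergodic eta * ((eta.2 ^+ 2)^-1 + w ^+ 2) `^ (- (nu + 2^-1)).
Proof. by rewrite /matern_density /microergodic !mulrA. Qed.

Lemma microergodic_ge0 eta : 0 <= microergodic eta.
Proof. by rewrite mulr_ge0 ?sqr_ge0 ?powR_ge0. Qed.

Lemma matern_coef_ge0 eta : 0 <= matern_amp * microergodic eta.
Proof. by apply: mulr_ge0; [exact/ltW/matern_amp_gt0|exact: microergodic_ge0]. Qed.

Let base_gt0 eta w : 0 < eta.2 -> 0 < (eta.2 ^+ 2)^-1 + w ^+ 2.
Proof. by move=> r0; rewrite ltr_wpDr ?sqr_ge0// invr_gt0 exprn_gt0. Qed.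

Lemma matern_density_ge0 eta w : 0 <= matern_density nu eta w.
Proof.
by rewrite matern_densityE; apply: mulr_ge0; [exact: matern_coef_ge0|exact: powR_ge0].
Qed.

Lemma matern_density_continuous eta : 0 < eta.2 -> continuous (matern_density nu eta).
Proof.
move=> r0; rewrite (_ : matern_density nu eta = fun w => matern_amp *
  microergodic eta * ((eta.2 ^+ 2)^-1 + w ^+ 2) `^ (- (nu + 2^-1))); last first.
  by apply/funext => w; rewrite matern_densityE.
move=> w.
apply: cvgM; first exact: cvg_cst.
apply: (@continuous_comp _ _ _ (fun w : R => (eta.2 ^+ 2)^-1 + w ^+ 2)
  (fun y : R => y `^ (- (nu + 2^-1)))).
  by apply: cvgD; [exact: cvg_cst|exact: sqr_continuous].
exact/continuous_powR/base_gt0.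
Qed.

Lemma matern_density_even eta w : matern_density nu eta (- w) = matern_density nu eta w.
Proof. by rewrite /matern_density sqrrN. Qed.

Lemma matern_density_le_tail eta w : 0 < eta.2 -> 0 < w ->
  matern_density nu eta w <=
    matern_amp * microergodic eta * w `^ (- (2 * nu + 1)).
Proof.
move=> r0 w0; rewrite matern_densityE ler_wpM2l ?matern_coef_ge0//.
have -> : - (2 * nu + 1) = 2%:R * - (nu + 2^-1) by field.
rewrite powRrM powR_mulrn ?(ltW w0)//.
rewrite !(powRN _ (nu + 2^-1)) lef_pV2 ?posrE ?powR_gt0 ?exprn_gt0 ?base_gt0//.
rewrite ge0_ler_powR ?nnegrE ?exprn_ge0 ?(ltW (base_gt0 _ _)) ?(ltW w0)//.
  by rewrite addr_ge0// ltW.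
by rewrite lerDr invr_ge0 exprn_ge0// ltW.
Qed.

Lemma matern_density_le0 eta w : 0 < eta.2 ->
  matern_density nu eta w <= matern_density nu eta 0.
Proof.
move=> r0; rewrite !matern_densityE ler_wpM2l ?matern_coef_ge0//.
rewrite !(powRN _ (nu + 2^-1)) lef_pV2 ?posrE ?powR_gt0 ?base_gt0//.
rewrite ge0_ler_powR ?nnegrE ?(ltW (base_gt0 _ _))//.
  by rewrite addr_ge0// ltW.
by rewrite expr0n/= addr0 lerDl sqr_ge0.
Qed.

Lemma matern_density_integrable eta : 0 < eta.2 ->
  mu.-integrable [set: R] (EFin \o matern_density nu eta).
Proof.
move=> r0; have cS := matern_density_continuous r0.
apply/integrableP; split.
  by apply/measurable_EFinP; exact: continuous_measurable_fun.
pose K := matern_amp * microergodic eta.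
have := @even_integral_le R nu nu0 (matern_density nu eta) 1
  (matern_density nu eta 0) K.
move=> /(_ ltr01) H.
under eq_integral do rewrite /= ger0_norm ?matern_density_ge0//.
apply: le_lt_trans (H _ _ _ _ _ _) (ltry _) => //.
- exact: matern_coef_ge0.
- exact: matern_density_ge0.
- by move=> x /=; rewrite matern_density_even.
- by move=> x _; exact: matern_density_le0.
- by move=> x x1; apply: matern_density_le_tail => //; apply: lt_trans x1.
Qed.

(** This monotonicity is what makes an overestimated range harmless: it only
    overestimates the covariance. *)
Lemma matern_density_le eta eta' w : 0 < eta.2 -> eta.2 <= eta'.2 ->
  microergodic eta = microergodic eta' ->
  matern_density nu eta w <= matern_density nu eta' w.
Proof.
move=> r0 rr' E.
have r0' := lt_le_trans r0 rr'.
rewrite !matern_densityE E ler_wpM2l ?matern_coef_ge0//.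
rewrite !(powRN _ (nu + 2^-1)) lef_pV2 ?posrE ?powR_gt0 ?base_gt0//.
rewrite ge0_ler_powR ?nnegrE ?(ltW (base_gt0 _ _))//.
  by rewrite addr_ge0// ltW.
by rewrite lerD2r lef_pV2 ?posrE ?exprn_gt0// lerXn2r// nnegrE ltW.
Qed.

(** The value at frequency [0] of the function whose supremum is [C_K] already
    controls the microergodic parameter; the supremum is finite because the
    density decays like [w^(-2 nu - 1)]. *)
Lemma C_K_ge eta : 0 < eta.2 ->
  matern_amp * microergodic eta * (eta.2 `^ (2 * nu + 1)) <= C_K nu eta.
Proof.
move=> r0; rewrite /C_K.
set A := [set _ | w in _].
have A0 : A (matern_amp * microergodic eta * (eta.2 `^ (2 * nu + 1))).
  exists 0 => //=.
  rewrite ger0_norm; last by rewrite mulr_ge0 ?matern_density_ge0 ?powR_ge0.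
  rewrite expr0n/= addr0 powR1 mulr1 matern_densityE expr0n/= addr0.
  congr (_ * _); rewrite -powR_invn; last exact: ltW.
  by rewrite -powRrM; congr (_ `^ _); field.
apply: (ub_le_sup _ A0).
exists (matern_amp * microergodic eta * (1 + eta.2 ^+ 2) `^ (nu + 2^-1)).
move=> _ [w _ <-].
rewrite ger0_norm; last by rewrite mulr_ge0 ?matern_density_ge0 ?powR_ge0.
rewrite matern_densityE -mulrA ler_wpM2l ?matern_coef_ge0//.
rewrite powRN ler_pdivrMl ?powR_gt0 ?base_gt0//.
rewrite -powRM ?(ltW (base_gt0 _ _)) ?addr_ge0 ?sqr_ge0//.
have h0 : 0 <= nu + 2^-1 by rewrite addr_ge0// ltW.
rewrite ge0_ler_powR// ?nnegrE ?mulr_ge0 ?addr_ge0 ?sqr_ge0 ?invr_ge0 ?sqr_ge0//.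
rewrite -subr_ge0.
rewrite (_ : _ - _ = (eta.2 ^+ 2)^-1 + w ^+ 2 * eta.2 ^+ 2); last first.
  by field; exact: (lt0r_neq0 r0).
by apply: addr_ge0; [rewrite invr_ge0 sqr_ge0|apply: mulr_ge0; exact: sqr_ge0].
Qed.

End density.

(** * Trigonometric polynomials *)

Section trig_poly.
Variable R : realType.
Local Open Scope complex_scope.
Implicit Types (z : R[i]) (q : {poly R}) (x : R).

Definition sqnormc z : R := complex.Re z ^+ 2 + complex.Im z ^+ 2.

Lemma sqnormcM z z' : sqnormc (z * z') = sqnormc z * sqnormc z'.
Proof. by case: z z' => [a b] [c d]; rewrite /sqnormc /=; ring. Qed.

Lemma sqnormcX z p : sqnormc (z ^+ p) = sqnormc z ^+ p.
Proof.
elim: p => [|p ih]; last by rewrite !exprS sqnormcM ih.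
by rewrite /sqnormc /= expr0n/= addr0 expr1n.
Qed.

Lemma sqnormc_eq0 z : (sqnormc z == 0) = (z == 0).
Proof.
by case: z => a b; rewrite /sqnormc paddr_eq0 ?sqr_ge0// !sqrf_eq0 eq_complex.
Qed.

Lemma sqnormc_ge0 z : 0 <= sqnormc z.
Proof. by rewrite addr_ge0 ?sqr_ge0. Qed.

Definition cis x : R[i] := cos x +i* sin x.

Lemma cisX x k : cis x ^+ k = cis (k%:R * x).
Proof.
elim: k => [|k ih]; first by rewrite expr0 mul0r /cis cos0 sin0.
rewrite exprS ih -natr1 mulrDl mul1r addrC /cis cosD sinD.
by apply/eqP; rewrite eq_complex /=; apply/andP; split; apply/eqP; ring.
Qed.

Lemma sqnormc_cis x : sqnormc (cis x) = 1.
Proof. by rewrite /sqnormc /= cos2Dsin2. Qed.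

Lemma sqnormc_1Bcis x : sqnormc (1 - cis x) = 2 - 2 * cos x.
Proof.
rewrite /sqnormc /= (_ : _ + _ = 1 - 2 * cos x + (cos x ^+ 2 + sin x ^+ 2)).
  by rewrite cos2Dsin2; ring.
by ring.
Qed.

(** The squared modulus of the trigonometric polynomial attached to [q]. *)
Definition trig_energy q x : R :=
  sqnormc (map_poly (real_complex R) q).[cis x].

Lemma trig_energy_ge0 q x : 0 <= trig_energy q x.
Proof. exact: sqnormc_ge0. Qed.

Lemma trig_energyE n (a : 'rV[R]_n) x : trig_energy (rVpoly a) x =
  \sum_i \sum_j a 0 i * a 0 j * cos ((i%:R - j%:R) * x).
Proof.
have H : (map_poly (real_complex R) (rVpoly a)).[cis x] =
   (\sum_(i < n) a 0 i * cos (i%:R * x)) +i* (\sum_(i < n) a 0 i * sin (i%:R * x)).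
  rewrite (@horner_coef_wide _ n); last first.
    by rewrite (leq_trans (size_poly _ _))// size_poly.
  under eq_bigr do rewrite coef_map coef_rVpoly_ord cisX.
  apply: (big_rec3 (fun (z : R[i]) (c s : R) => z = c +i* s)) => // i z c s _ ->.
  apply/eqP; rewrite eq_complex /=; apply/andP; split; apply/eqP; ring.
rewrite /trig_energy H /sqnormc /= !expr2 !big_distrlr/= -big_split/=.
apply: eq_bigr => i _; rewrite -big_split/=; apply: eq_bigr => j _.
by rewrite mulrBl cosB; ring.
Qed.

Lemma trig_energy_le n (a : 'rV[R]_n) :
  exists B, forall x, trig_energy (rVpoly a) x <= B.
Proof.
exists (\sum_i \sum_j `|a 0 i * a 0 j|) => x; rewrite trig_energyE.
apply: ler_sum => i _; apply: ler_sum => j _.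
apply: (le_trans (ler_norm _)); rewrite normrM ler_piMr//.
by rewrite ler_norml cos_geN1 cos_le1.
Qed.

Lemma continuous_trig_energy n (a : 'rV[R]_n) (c : R) :
  continuous (fun x => trig_energy (rVpoly a) (x / c)).
Proof.
rewrite (_ : (fun x => _) = fun x : R => \sum_i \sum_j a 0 i * a 0 j *
    cos ((i%:R - j%:R) * (x / c))); last first.
  by apply/funext => x; rewrite trig_energyE.
move=> x; apply: cvg_big => [|i _]; first exact: add_continuous.
apply: cvg_big => [|j _]; first exact: add_continuous.
apply: cvgM; first exact: cvg_cst.
apply: (@continuous_comp _ _ _ (fun x : R => (i%:R - j%:R) * (x / c)) cos).
  apply: cvgM; first exact: cvg_cst.
  by apply: cvgM; [exact: cvg_id|exact: cvg_cst].
exact: continuous_cos.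
Qed.

(** A nonzero polynomial cannot vanish at the infinitely many points
    [k/(n+1) + i sqrt(1 - (k/(n+1))^2)] of the unit circle. *)
Lemma trig_energy_neq0 q : q != 0 -> exists x, trig_energy q x != 0.
Proof.
move=> q0; apply: contrapT => /forallNP H.
have {}H x : root (map_poly (real_complex R) q) (cis x).
  by rewrite /root -sqnormc_eq0; apply/negPn/negP => /(H x).
(* The real parts [k / (n + 1)] separate the points. *)
pose n := size q; pose y k : R := k%:R / n.+1%:R.
pose rs := [seq cis (acos (y k)) | k <- iota 0 n.+1].
have yb k : k \in iota 0 n.+1 -> -1 <= y k <= 1.
  rewrite mem_iota add0n /= => kn; apply/andP; split.
    by rewrite (@le_trans _ _ 0)// ?lerN10 // divr_ge0.
  by rewrite ler_pdivrMr// mul1r ler_nat ltnW.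
have : (size rs < size (map_poly (real_complex R) q))%N.
  apply: max_poly_roots.
  - by rewrite map_poly_eq0.
  - by apply/allP => _ /mapP[k _ ->].
  - rewrite map_inj_in_uniq ?iota_uniq// => i j /yb iy /yb jy [+ _].
    rewrite !acosK ?in_itv//= => /(congr1 ( *%R^~ n.+1%:R)).
    by rewrite /= !divfK ?pnatr_eq0// => /eqP; rewrite eqr_nat => /eqP.
by rewrite size_map size_iota size_map_poly ltnNge leqnSn.
Qed.

(** [2 - 2 cos x = 4 sin^2 (x / 2)], and the mean value theorem bounds the
    sine. *)
Lemma two_minus_2cos_le x : 2 - 2 * cos x <= x ^+ 2.
Proof.
have sin_le (t : R) : 0 <= t -> `|sin t| <= t.
  move=> t0.
  have cs : {within `[0, t], continuous (@sin R)}.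
    by apply: continuous_subspaceT => u; exact: continuous_sin.
  have [c _] := @MVT_segment R (@sin R) cos 0 t t0 (fun x _ => is_derive_sin x) cs.
  rewrite sin0 !subr0 => ->; rewrite normrM (ger0_norm t0) ler_piMl//.
  by rewrite ler_norml cos_geN1 cos_le1.
wlog x0 : x / 0 <= x.
  have [x0|/ltW x0] := leP 0 x; first exact.
  by move=> /(_ (- x)); rewrite cosN sqrrN oppr_ge0; exact.
have x20 : 0 <= x / 2 by rewrite divr_ge0.
have -> : x = x / 2 *+ 2 by rewrite -mulr_natr divfK.
have := sin_le _ x20.
have := cos2Dsin2 (x / 2); rewrite mulr2n cosD -!expr2 => E.
rewrite -(ler_pXn2r (n := 2)) ?nnegrE// real_normK ?num_real// => S.
rewrite (_ : (x / 2 + x / 2) ^+ 2 = 4 * (x / 2) ^+ 2); last by ring.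
by move: S E; move: (cos _ ^+ 2) (sin _ ^+ 2) ((x / 2) ^+ 2) => c s h; lra.
Qed.

End trig_poly.

(** * Matern covariance matrices *)

Section cov_matrix.
Variable R : realType.
Local Notation mu := (@lebesgue_measure R).
Variable nu : R.
Hypothesis nu0 : 0 < nu.
Implicit Types eta : R * R.

Definition qform n (M : 'M[R]_n) (a : 'rV[R]_n) : R := (a *m M *m a^T) 0 0.

Lemma qformE n (M : 'M[R]_n) (a : 'rV[R]_n) :
  qform M a = \sum_i \sum_j a 0 i * a 0 j * M i j.
Proof.
rewrite /qform mxE exchange_big /=; apply: eq_bigr => j _.
rewrite mxE mulr_suml; apply: eq_bigr => i _.
by rewrite mxE mulrAC.
Qed.

Lemma Rintegral_sum (I : Type) (s : seq I) (f : I -> R -> R) :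
  (forall i, mu.-integrable [set: R] (EFin \o f i)) ->
  mu.-integrable [set: R] (EFin \o (fun x => \sum_(i <- s) f i x)) /\
  \int[mu]_(x in [set: R]) (\sum_(i <- s) f i x) =
  \sum_(i <- s) \int[mu]_(x in [set: R]) f i x.
Proof.
move=> fi; elim: s => [|i s [ih1 ih2]].
  split.
    rewrite (_ : EFin \o _ = cst 0%E); first exact: integrable0.
    by apply/funext => x; rewrite /= big_nil.
  under eq_Rintegral do rewrite big_nil.
  by rewrite Rintegral_cst// mul0r big_nil.
split.
  rewrite (_ : EFin \o _ = (fun x => (f i x)%:E +
     (\sum_(i <- s) f i x)%R%:E)%E).
    exact: (integrableD _ (fi i) ih1).
  by apply/funext => x; rewrite /= big_cons EFinD.
under eq_Rintegral do rewrite big_cons.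
by rewrite RintegralD// ih2 big_cons.
Qed.

Lemma integrable_mul_bounded (S h : R -> R) (B : R) :
  mu.-integrable [set: R] (EFin \o S) -> measurable_fun [set: R] h ->
  (forall x, `|h x| <= B) ->
  mu.-integrable [set: R] (EFin \o (fun x => S x * h x)).
Proof.
move=> Si mh hB.
have B0 : 0 <= B by apply: le_trans (normr_ge0 _) (hB 0).
apply: (@le_integrable _ _ _ mu _ _ _ (fun u => B%:E * (EFin \o S) u)%E) => //.
- apply/measurable_EFinP/measurable_funM => //.
  by apply/measurable_EFinP; exact: (measurable_int mu).
- move=> x _ /=; rewrite lee_fin !normrM (ger0_norm B0) mulrC.
  by rewrite ler_wpM2r.
- exact: integrableZl.
Qed.

(** The spectral representation of the covariance: a linear combination of the
    samples has as variance the density integrated against the squared modulus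
    of its transfer function. *)
Lemma qform_cov eta n (a : 'rV[R]_n) : 0 < eta.2 ->
  qform (cov_mx nu eta n) a = (2 * pi)^-1 *
    \int[mu]_(w in [set: R])
      (matern_density nu eta w * trig_energy (rVpoly a) (w / n%:R)).
Proof.
move=> r0; have Si := matern_density_integrable nu0 r0.
pose g (i j : 'I_n) (w : R) := matern_density nu eta w *
  cos (w * ((i.+1%:R - j.+1%:R) / n%:R)).
have gi i j : mu.-integrable [set: R] (EFin \o g i j).
  apply: (@integrable_mul_bounded _ _ 1) => //.
    apply: continuous_measurable_fun.
    move=> x; apply: (@continuous_comp _ _ _
      (fun w : R => w * ((i.+1%:R - j.+1%:R) / n%:R)) cos).
      by apply: cvgM; [exact: cvg_id|exact: cvg_cst].
    exact: continuous_cos.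
  by move=> x; rewrite ler_norml cos_geN1 cos_le1.
pose h (ij : 'I_n * 'I_n) (w : R) := a 0 ij.1 * a 0 ij.2 * g ij.1 ij.2 w.
have hi ij : mu.-integrable [set: R] (EFin \o h ij).
  exact: (@integrableZl _ _ _ mu _ _ (a 0 ij.1 * a 0 ij.2) _ (gi ij.1 ij.2)).
have [_ E] := Rintegral_sum (index_enum _) hi.
rewrite (_ : \int[mu]_(w in _) _ = \int[mu]_(w in [set: R]) \sum_ij h ij w); last first.
  apply: eq_Rintegral => w _.
  rewrite trig_energyE mulr_sumr (eq_bigr (fun ij => h (ij.1, ij.2) w)); last by case.
  rewrite -(pair_bigA _ (fun i j => h (i, j) w)) /=; apply: eq_bigr => i _.
  rewrite mulr_sumr; apply: eq_bigr => j _.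
  rewrite /h /g /= -!natr1 mulrCA; congr (_ * (_ * cos _)); ring.
rewrite E mulr_sumr qformE pair_bigA /=; apply: eq_bigr => ij _.
rewrite RintegralZl// mulrCA; congr (_ * _).
by rewrite mxE /matern_cov /spectral_cov.
Qed.

Lemma trig_cov_integrable eta n (a : 'rV[R]_n) (c : R) : 0 < eta.2 ->
  mu.-integrable [set: R] (EFin \o
    (fun w => matern_density nu eta w * trig_energy (rVpoly a) (w / c))).
Proof.
move=> r0; have [B HB] := trig_energy_le a.
apply: (@integrable_mul_bounded _ _ B) => //.
- exact: matern_density_integrable.
- apply: continuous_measurable_fun; exact: continuous_trig_energy.
- by move=> x; rewrite ger0_norm ?trig_energy_ge0.
Qed.

Let pi2_gt0 : 0 < (2 * pi)^-1 :> R.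
Proof. by rewrite invr_gt0 mulr_gt0 ?pi_gt0. Qed.

Lemma qform_cov_ge0 eta n (a : 'rV[R]_n) : 0 < eta.2 ->
  0 <= qform (cov_mx nu eta n) a.
Proof.
move=> r0; rewrite qform_cov// mulr_ge0 ?(ltW pi2_gt0)// Rintegral_ge0// => w _.
by rewrite mulr_ge0 ?matern_density_ge0 ?trig_energy_ge0.
Qed.

Lemma qform_cov_le eta eta' n (a : 'rV[R]_n) : 0 < eta.2 -> eta.2 <= eta'.2 ->
  microergodic nu eta = microergodic nu eta' ->
  qform (cov_mx nu eta n) a <= qform (cov_mx nu eta' n) a.
Proof.
move=> r0 rr' E; have r0' := lt_le_trans r0 rr'.
rewrite !qform_cov// ler_wpM2l ?(ltW pi2_gt0)//.
apply: le_Rintegral => //; try exact: trig_cov_integrable.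
by move=> w _; rewrite ler_wpM2r ?trig_energy_ge0// matern_density_le.
Qed.

(** The spectral density is everywhere positive and a nonzero trigonometric
    polynomial does not vanish identically. *)
Lemma qform_cov_gt0 eta n (a : 'rV[R]_n) : 0 < eta.1 -> 0 < eta.2 -> a != 0 ->
  0 < qform (cov_mx nu eta n) a.
Proof.
move=> s0 r0 a0; rewrite qform_cov// pmulr_rgt0//.
have n0 : (0 < n)%N.
  by rewrite lt0n; apply: contraNneq a0 => n0; subst n; rewrite thinmx0.
have nR : 0 < n%:R :> R by rewrite ltr0n.
have q0 : rVpoly a != 0.
  by apply: contraNneq a0 => q0; rewrite -(rVpolyK a) q0 linear0.
have [x ex] := trig_energy_neq0 q0.
pose g w := matern_density nu eta w * trig_energy (rVpoly a) (w / n%:R).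
pose w0 := x * n%:R.
have Sgt0 w : 0 < matern_density nu eta w.
  rewrite matern_densityE; apply: mulr_gt0; last first.
    by rewrite powR_gt0// ltr_wpDr ?sqr_ge0// invr_gt0 exprn_gt0.
  apply: mulr_gt0; first exact: matern_amp_gt0.
  by rewrite /microergodic mulr_gt0 ?powR_gt0 ?exprn_gt0.
have g0 : 0 < g w0.
  rewrite /g mulr_gt0// /w0 mulfK ?gt_eqF//.
  by rewrite lt_neqAle eq_sym ex trig_energy_ge0.
have cg : continuous g.
  move=> w; apply: cvgM; first exact: matern_density_continuous.
  exact: continuous_trig_energy.
have : \forall w \near w0, g w0 / 2 < g w.
  have gh : g w0 / 2 < g w0 by rewrite ltr_pdivrMr// ltr_pMr// ltr1n.
  exact: (@cvgr_gt _ _ _ _ g (g w0) (cg w0) _ gh).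
move=> /nbhs_ballP[e /= e0 He].
apply: (@Rintegral_gt0 _ _ _ w0 (w0 + e) (g w0 / 2)) => //.
- exact: trig_cov_integrable.
- by move=> w _; rewrite mulr_ge0 ?matern_density_ge0 ?trig_energy_ge0.
- by rewrite ltrDl.
- by rewrite divr_gt0.
- move=> w /andP[w1 w2]; split => //; apply/ltW/He.
  by rewrite /ball/= distrC ger0_norm ?subr_ge0 ?(ltW w1)// ltrBlDl.
Qed.

Lemma cov_mx_unit eta n : 0 < eta.1 -> 0 < eta.2 -> cov_mx nu eta n \in unitmx.
Proof.
move=> s0 r0; rewrite -row_free_unit -kermx_eq0; apply/negPn/negP => /rowV0Pn[u].
move=> /sub_kermxP uM u0; have := qform_cov_gt0 s0 r0 u0.
by rewrite /qform uM mul0mx mxE ltxx.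
Qed.

Lemma cov_mx_sym eta n : (cov_mx nu eta n)^T = cov_mx nu eta n.
Proof.
apply/matrixP => i j; rewrite !mxE /matern_cov /spectral_cov; congr (_ * _).
apply: eq_Rintegral => w _; rewrite -cosN -mulrN -mulNr opprB//.
Qed.

Lemma cov_mx_scale s rho n : 0 < rho ->
  cov_mx nu (s, rho) n = s ^+ 2 *: cov_mx nu (1, rho) n.
Proof.
move=> r0; apply/matrixP => i j; rewrite !mxE /matern_cov /spectral_cov mulrCA.
congr (_ * _).
rewrite -RintegralZl//.
  apply: eq_Rintegral => w _; rewrite !matern_densityE /microergodic /=; ring.
apply: (@integrable_mul_bounded _ _ 1) => //.
- exact: matern_density_integrable.
- apply: continuous_measurable_fun.
  move=> x; apply: (@continuous_comp _ _ _ (fun w : R => w * _) cos).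
    by apply: cvgM; [exact: cvg_id|exact: cvg_cst].
  exact: continuous_cos.
- by move=> x; rewrite ler_norml cos_geN1 cos_le1.
Qed.

End cov_matrix.

(** * Finite differences straddling a change point *)

Section cauchy_schwarz.
Variable R : realType.

Lemma qform_cauchy_schwarz n (M : 'M[R]_n) (a x : 'rV[R]_n) :
  M^T = M -> (forall y, 0 <= qform M y) -> 0 < qform M a ->
  ((a *m M *m x^T) 0 0) ^+ 2 <= qform M a * qform M x.
Proof.
move=> Ms M0 a0.
pose p := qform M a; pose q := (a *m M *m x^T) 0 0.
have sq : (x *m M *m a^T) 0 0 = q.
  by rewrite /q -[a *m M *m x^T]trmxK [RHS]mxE !trmx_mul trmxK Ms mulmxA.
have := M0 (p *: x - q *: a).
have -> : qform M (p *: x - q *: a) = p * (p * qform M x - q ^+ 2).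
  rewrite /qform.
  have -> : (p *: x - q *: a) *m M *m (p *: x - q *: a)^T =
    p *: (p *: (x *m M *m x^T) - q *: (x *m M *m a^T))
    - q *: (p *: (a *m M *m x^T) - q *: (a *m M *m a^T)).
    rewrite [(_ - _)^T]linearB /= ![(_ *: _)^T]linearZ /= !mulmxBl -!scalemxAl.
    by rewrite !mulmxBr -!scalemxAr.
  move: sq; rewrite {}/q {}/p /qform.
  move: (x *m M *m x^T) (x *m M *m a^T) (a *m M *m x^T) (a *m M *m a^T) => A B C D.
  by rewrite !mxE => ->; ring.
by rewrite pmulr_rge0// subr_ge0.
Qed.

(** Any test vector [a] bounds [z^T M^-1 z] from below without inverting [M];
    this is Cauchy-Schwarz for the inner product of [M] applied to [a] and
    [M^-1 z]. *)
Lemma whitened_sqr_ge n (M : 'M[R]_n) (a : 'rV[R]_n) (z : 'cV[R]_n) :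
  M^T = M -> M \in unitmx -> (forall y, 0 <= qform M y) -> 0 < qform M a ->
  ((a *m z) 0 0) ^+ 2 <= qform M a * (z^T *m invmx M *m z) 0 0.
Proof.
move=> Ms Mu M0 a0.
have := qform_cauchy_schwarz (z^T *m invmx M) Ms M0 a0.
have -> : (z^T *m invmx M)^T = invmx M *m z.
  by rewrite trmx_mul trmxK trmx_inv Ms.
rewrite mulmxA mulmxK//.
rewrite /qform trmx_mul trmxK trmx_inv Ms.
by rewrite mulmxKV// mulmxA.
Qed.
End cauchy_schwarz.

Section stencil.
Variable R : realType.
Variable nu : R.
Hypothesis nu0 : 0 < nu.

(** Coefficients of a [p]-th order finite difference on the points
    [t, t+1, ..., t+p]. *)
Definition stencil (p t : nat) : {poly R} := 'X^(t.-1) * (1 - 'X) ^+ p.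

Lemma size_stencil p t n : (0 < t)%N -> (t + p <= n)%N ->
  (size (stencil p t) <= n)%N.
Proof.
move=> t0 tpn; apply: leq_trans tpn.
rewrite /stencil mulrC size_mulXn; last first.
  rewrite expf_neq0// subr_eq0 eq_sym.
  by apply/negP => /eqP/(congr1 (fun q : {poly R} => size q)); rewrite size_polyX size_poly1.
have -> : size ((1 - 'X) ^+ p : {poly R}) = p.+1.
  by rewrite -opprB exprNn size_Msign -polyC1 size_exp_XsubC.
by rewrite addnS -addSn prednK.
Qed.

Lemma trig_energy_stencil p t x :
  trig_energy (stencil p t) x = (2 - 2 * cos x) ^+ p.
Proof.
rewrite /trig_energy /stencil rmorphM rmorphXn rmorphXn rmorphB rmorph1 /=.
rewrite map_polyX !hornerE ?hornerXn ?horner_exp ?hornerE sqnormcM !sqnormcX sqnormc_cis expr1n mul1r.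
by rewrite sqnormc_1Bcis.
Qed.

(** The coefficients of [(1 - X)^p] sum to [0], so the sum against the sign
    pattern is minus twice the sum over the points up to [t], and the point [t]
    with coefficient [1] is the only one of these. *)
Lemma stencil_zeta p t n : (0 < p)%N -> (0 < t)%N -> (t + p <= n)%N ->
  ((poly_rV (stencil p t) : 'rV_n) *m sample n (zeta R t)) 0 0 = - 2.
Proof.
move=> p0 t0 tpn.
have sz := size_stencil t0 tpn.
have s1 : \sum_(i < n) (stencil p t)`_i = 0.
  transitivity (stencil p t).[1].
    by rewrite (horner_coef_wide _ sz); apply: eq_bigr => i _; rewrite expr1n mulr1.
  by rewrite /stencil hornerM horner_exp !hornerE subrr expr0n gtn_eqF// mulr0.
rewrite mxE.
under eq_bigr do rewrite !mxE.
have tn : (t.-1 < n)%N by rewrite prednK// (leq_trans _ tpn)// leq_addr.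
have st : (stencil p t)`_t.-1 = 1.
  rewrite /stencil coefXnM ltnn subnn -horner_coef0 horner_exp !hornerE.
  by rewrite subr0 expr1n.
transitivity (\sum_(i < n) ((stencil p t)`_i - 2 * (if i == Ordinal tn then 1 else 0))).
  apply: eq_bigr => i _; rewrite /zeta -val_eqE /=.
  have [it|ti] := leqP i.+1 t.
    have [->|ne] := eqVneq (i : nat) t.-1; first by rewrite st; ring.
    rewrite /stencil coefXnM ifT; first by ring.
    by rewrite ltn_neqAle ne/= -ltnS prednK.
  rewrite gtn_eqF ?mulr0 ?subr0 ?mulr1//.
  by rewrite prednK.
by rewrite sumrB s1 -mulr_sumr -big_mkcond /= big_pred1_eq mulr1 sub0r.
Qed.

(** Below the frequency [n] the stencil contributes a factor
    [(w / n)^(2 p)] that compensates the growth of [w^(- 2 nu - 1)] towards the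
    origin; beyond [n] the tail of the density integrates to [n^(- 2 nu)]. *)
Lemma qform_stencil_le (eta : R * R) (p t n : nat) : 0 < eta.2 ->
  2 * nu + 1 <= (2 * p)%:R -> (0 < t)%N -> (t + p <= n)%N ->
  qform (cov_mx nu eta n) (poly_rV (stencil p t)) <=
  (2 * pi)^-1 * (2 * (matern_amp nu * microergodic nu eta *
     (1 + 4 ^+ p / (2 * nu)))) * n%:R `^ (- (2 * nu)).
Proof.
move=> r0 pnu t0 tpn.
set K := matern_amp nu * microergodic nu eta.
have K0 : 0 <= K by apply: matern_coef_ge0.
have n0 : 0 < n%:R :> R by rewrite ltr0n (leq_trans _ tpn)// addn_gt0 t0.
rewrite qform_cov// poly_rV_K ?size_stencil// -mulrA ler_wpM2l//.
  by rewrite invr_ge0 mulr_ge0// pi_ge0.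
have osc0 x : 0 <= 2 - 2 * cos x by rewrite subr_ge0 ler_piMr// cos_le1.
pose f w := matern_density nu eta w * (2 - 2 * cos (w / n%:R)) ^+ p.
rewrite (_ : \int[_]_(w in _) _ = \int[lebesgue_measure]_(w in [set: R]) f w); last first.
  by apply: eq_Rintegral => w _; rewrite trig_energy_stencil.
have fi : lebesgue_measure.-integrable [set: R] (EFin \o f).
  rewrite (_ : f = fun w => matern_density nu eta w *
    trig_energy (rVpoly (poly_rV (stencil p t) : 'rV_n)) (w / n%:R)).
    exact: trig_cov_integrable.
  by apply/funext => w; rewrite poly_rV_K ?size_stencil// trig_energy_stencil.
have f0 w : 0 <= f w by rewrite mulr_ge0 ?matern_density_ge0 ?exprn_ge0.
have cf : continuous f.
  move=> w; apply: cvgM; first exact: matern_density_continuous.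
  apply: (@continuous_comp _ _ _ (fun w : R => 2 - 2 * cos (w / n%:R)) (fun y => y ^+ p)).
    apply: cvgB; first exact: cvg_cst.
    apply: cvgM; first exact: cvg_cst.
    apply: (@continuous_comp _ _ _ (fun w : R => w / n%:R) cos).
      by apply: cvgM; [exact: cvg_id|exact: cvg_cst].
    exact: continuous_cos.
  exact: exprn_continuous.
have p0 : (0 < p)%N.
  rewrite lt0n; apply/negP => /eqP p00; move: pnu; rewrite p00 muln0.
  by rewrite leNgt ltr_wpDl// mulr_ge0// ltW.
have H := @even_integral_le R nu nu0 f n%:R (K * n%:R `^ (- (2 * nu + 1)))
  (K * 4 ^+ p) n0.
rewrite -lee_fin fineK; last exact: integrable_fin_num.
apply: le_trans (H _ _ _ _ _ _) _ => //.
- by rewrite mulr_ge0 ?exprn_ge0.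
- by move=> x; rewrite /f /= matern_density_even mulNr cosN.
- move=> x /andP[]; rewrite le_eqVlt => /predU1P[<-|x0] xn.
    by rewrite /f mul0r cos0 mulr1 subrr expr0n gtn_eqF// mulr0 mulr_ge0 ?powR_ge0.
  apply: (@le_trans _ _ (K * x `^ (- (2 * nu + 1)) * ((x / n%:R) ^+ 2) ^+ p)).
    apply: ler_pM; rewrite ?matern_density_ge0 ?exprn_ge0//.
      exact: matern_density_le_tail.
    by rewrite lerXn2r ?nnegrE ?sqr_ge0// two_minus_2cos_le.
  rewrite -mulrA ler_wpM2l//.
  rewrite -exprM -powR_mulrn ?divr_ge0 ?(ltW x0) ?(ltW n0)//.
  rewrite powRM ?invr_ge0 ?(ltW x0) ?(ltW n0)// mulrA -powRD ?(gt_eqF x0) ?implybT//.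
  rewrite -powR_inv1 ?(ltW n0)// -powRrM mulN1r.
  rewrite [leRHS](_ : _ = n%:R `^ ((2 * p)%:R - (2 * nu + 1)) * n%:R `^ (- (2 * p)%:R)).
    rewrite ler_wpM2r ?powR_ge0// addrC ge0_ler_powR ?nnegrE ?(ltW x0) ?(ltW n0)//.
    by rewrite subr_ge0.
  by rewrite -powRD ?(gt_eqF n0) ?implybT//; congr (_ `^ _); ring.
- move=> x nx; have x0 : 0 < x by apply: lt_trans nx.
  rewrite mulrAC; apply: ler_pM; rewrite ?matern_density_ge0 ?exprn_ge0//.
    exact: matern_density_le_tail.
  rewrite lerXn2r ?nnegrE//.
  by have := cos_geN1 (x / n%:R); lra.
rewrite lee_fin.
have -> : K * n%:R `^ (- (2 * nu + 1)) * n%:R = K * n%:R `^ (- (2 * nu)).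
  rewrite -mulrA -[X in _ `^ _ * X]powRr1 ?(ltW n0)// -powRD ?(gt_eqF n0) ?implybT//.
  by congr (_ * _ `^ _); ring.
rewrite le_eqVlt; apply/orP; left; apply/eqP; field.
by rewrite gt_eqF.
Qed.

End stencil.

(** * Gaussian tails *)

Section gaussian.
Variable R : realType.
Local Notation mu := (@lebesgue_measure R).

Lemma measurable_dist_ge (c v : R) : measurable [set x : R | v <= `|x - c|].
Proof.
have mf : measurable_fun [set: R] (fun x : R => `|x - c|).
  by apply: measurableT_comp => //; exact: measurable_funB.
rewrite (_ : [set x | _] = (fun x : R => `|x - c|) @^-1` `[v, +oo[%classic).
  by rewrite -[X in measurable X]setTI; exact: mf.
by apply/seteqP; split => x /=; rewrite in_itv/= andbT.
Qed.

Lemma measurable_EFin_normal_pdf (m s : R) (D : set R) :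
  measurable_fun D (fun x => (normal_pdf m s x)%:E).
Proof.
by apply/measurable_funTS/measurable_EFinP; exact: measurable_normal_pdf.
Qed.

(** On [|x - m| >= u] half of the exponent of the density is at most
    [- u^2 / (4 s^2)]; the other half is, up to [sqrt 2], the density of the
    normal law of standard deviation [sqrt 2 * s]. *)
Lemma normal_prob_tail (m s u : R) : 0 < s -> 0 <= u ->
  (normal_prob m s [set x | (u <= `|x - m|)%R]
    <= (2 * expR (- (u ^+ 2 / (4 * s ^+ 2))))%:E)%E.
Proof.
move=> s0 u0; pose s2 := Num.sqrt 2 * s; pose e := expR (- (u ^+ 2 / (4 * s ^+ 2))).
have q20 : 0 < Num.sqrt 2 :> R by rewrite sqrtr_gt0.
have s20 : 0 < s2 by rewrite mulr_gt0.
have s22 : s2 ^+ 2 = 2 * s ^+ 2 by rewrite exprMn sqr_sqrtr.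
have pk : normal_peak s = Num.sqrt 2 * normal_peak s2.
  have E : s2 ^+ 2 * pi *+ 2 = 2 * (s ^+ 2 * pi *+ 2) by rewrite s22; ring.
  by rewrite /normal_peak E (sqrtrM (s ^+ 2 * pi *+ 2))// invfM mulrA divff ?mul1r// gt_eqF.
rewrite /normal_prob.
set A := [set x | _].
have mA : measurable A by exact: measurable_dist_ge.
have e0 : 0 <= e by exact: expR_ge0.
apply: (@le_trans _ _ (\int[mu]_(x in A) ((2 * e) * normal_pdf m s2 x)%:E)%E).
  apply: ge0_le_integral => //.
  - by move=> x _; rewrite lee_fin normal_pdf_ge0.
  - exact: measurable_EFin_normal_pdf.
  - apply/measurable_EFinP/measurable_funM => //.
    by apply/measurable_funTS; exact: measurable_normal_pdf.
  move=> x /= ux; rewrite lee_fin !normal_pdfE ?gt_eqF// pk.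
  have fE : normal_fun m s x <= e * normal_fun m s2 x.
    rewrite /normal_fun /e -expRD ler_expR s22.
    have s24 : 0 < 4 * s ^+ 2 by rewrite mulr_gt0// exprn_gt0.
    rewrite (_ : - (x - m) ^+ 2 / (s ^+ 2 *+ 2) =
      - ((x - m) ^+ 2 / (4 * s ^+ 2)) + - (x - m) ^+ 2 / (2 * s ^+ 2 *+ 2)); last first.
      by field; rewrite gt_eqF.
    rewrite lerD2r lerN2 ler_pM2r ?invr_gt0// -[leRHS]real_normK ?num_real//.
    by rewrite lerXn2r ?nnegrE.
  have q2 : Num.sqrt 2 <= 2 :> R.
    by rewrite -[leRHS]ger0_norm// -sqrtr_sqr ler_sqrt ?sqr_ge0//; lra.
  rewrite [leRHS](_ : _ = (2 * normal_peak s2) * (e * normal_fun m s2 x)); last by ring.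
  apply: ler_pM => //.
  - by rewrite mulr_ge0 ?normal_peak_ge0// ltW.
  - exact: normal_fun_ge0.
  - by rewrite ler_wpM2r ?normal_peak_ge0.
under eq_integral do rewrite EFinM.
rewrite ge0_integralZl//; last 3 first.
- exact: measurable_EFin_normal_pdf.
- by move=> x _; rewrite lee_fin normal_pdf_ge0.
- by rewrite lee_fin mulr_ge0.
rewrite -[leRHS]mule1; apply: lee_wpmul2l; first by rewrite lee_fin mulr_ge0.
exact: (@probability_le1 _ _ _ (normal_prob m s2) A mA).
Qed.

(** The density is at most [1 / (s sqrt (2 pi))], hence an interval of length
    [s] has mass at most [1 / 2].  Through Chebyshev this bounds [s] by any
    second moment, and no moment of the normal law has to be computed. *)
Lemma normal_prob_near (m s c : R) : 0 < s ->
  (2^-1%:E <= normal_prob m s [set x | (s / 2 <= `|x - c|)%R])%E.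
Proof.
move=> s0; set A := [set x | _].
have mA : measurable A by exact: measurable_dist_ge.
have mAc : measurable (~` A) by exact: measurableC.
have : (normal_prob m s (~` A) <= 2^-1%:E)%E.
  have -> : ~` A = `]c - s / 2, c + s / 2[%classic.
    apply/seteqP; split => x /=; rewrite in_itv/=.
      by move/negP; rewrite -ltNge ltr_distl.
    by move=> H; apply/negP; rewrite -ltNge ltr_distl.
  apply: (@le_trans _ _ (\int[mu]_(x in `](c - s / 2)%R, (c + s / 2)%R[) (normal_peak s)%:E)%E).
    apply: ge0_le_integral => //.
    - by move=> x _; rewrite lee_fin normal_pdf_ge0.
    - exact: measurable_EFin_normal_pdf.
    by move=> x _; rewrite lee_fin normal_pdf_ub// gt_eqF.
  rewrite integral_cst//= lebesgue_measure_itv/= lte_fin.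
  have -> : c - s / 2 < c + s / 2 by lra.
  rewrite -EFinD -EFinM lee_fin.
  have -> : c + s / 2 - (c - s / 2) = s by field.
  rewrite /normal_peak -mulrnAr sqrtrM ?sqr_ge0// sqrtr_sqr gtr0_norm// invfM.
  have p2 : 4 <= pi *+ 2 :> R by have := pi_ge2 R; lra.
  have p20 : 0 < pi *+ 2 :> R by apply: lt_le_trans p2.
  rewrite mulrAC mulVf ?gt_eqF// mul1r lef_pV2 ?posrE ?sqrtr_gt0//.
  rewrite -[leLHS]ger0_norm// -sqrtr_sqr ler_sqrt ?(ltW p20)//.
  by apply: le_trans p2; lra.
have -> : normal_prob m s (~` A) = (1 - normal_prob m s A)%E.
  exact: (@probability_setC _ _ R (normal_prob m s) A mA).
have /fineK <- : normal_prob m s A \is a fin_num by apply: fin_num_measure.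
by rewrite -EFinB !lee_fin; lra.
Qed.

Section law.
Variables (d : measure_display) (T : measurableType d) (P : probability T R).

Lemma chebyshev_center (Y : T -> R) (c V e : R) : measurable_fun [set: T] Y ->
  0 < e -> (\int[P]_w ((Y w - c) ^+ 2)%:E <= V%:E)%E ->
  (P [set w | (e <= `|Y w - c|)%R] <= (V / e ^+ 2)%:E)%E.
Proof.
move=> mY e0 YV.
set A := [set w | _].
have mf : measurable_fun [set: T] (fun w => (Y w - c) ^+ 2).
  by apply: measurable_funX; exact: measurable_funB.
have mA : measurable A.
  rewrite (_ : A = Y @^-1` [set x | e <= `|x - c|])//.
  by rewrite -[X in measurable X]setTI; apply: mY => //; exact: measurable_dist_ge.
have : (\int[P]_(w in A) (e ^+ 2)%:E <= V%:E)%E.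
  apply: le_trans YV.
  apply: (@le_trans _ _ (\int[P]_(w in A) ((Y w - c) ^+ 2)%:E)%E).
    apply: ge0_le_integral => //.
    - by move=> w _; rewrite lee_fin sqr_ge0.
    - exact/measurable_EFinP/measurable_funTS.
    move=> w /= ew; rewrite lee_fin -[leRHS]real_normK ?num_real//.
    by rewrite lerXn2r ?nnegrE// ltW.
  apply: ge0_subset_integral => //.
  - exact/measurable_EFinP.
  - by move=> w _; rewrite lee_fin sqr_ge0.
have PA : P A = (fine (P A))%:E by rewrite fineK//; exact: fin_num_measure.
have -> : (\int[P]_(w in A) (e ^+ 2)%:E)%E = (e ^+ 2 * fine (P A))%:E.
  by rewrite integral_cst// [RHS]EFinM; congr (_ * _)%E; exact: PA.
rewrite PA !lee_fin.
by rewrite ler_pdivlMr ?exprn_gt0// mulrC.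
Qed.

(** The mean [m] and deviation [s] of the law are only known through the second
    moment about [c].  A Dirac mass lies within [2 sqrt V] of [c] by Chebyshev.  If
    [s > 0], Chebyshev and [normal_prob_near] give [s <= 3 sqrt V]; then the
    events [|Y - c| < 2 sqrt V] and [|Y - m| < 4 s] have total probability
    greater than [1], so they intersect and [|m - c| <= 14 sqrt V].  From [28 sqrt V] on, a deviation [v] from [c]
    is thus a deviation of at least [v / 2] from [m]. *)
Lemma gaussian_tail (Y : T -> R) (c V v : R) : measurable_fun [set: T] Y ->
  gaussian_law P Y -> 0 < V -> (\int[P]_w ((Y w - c) ^+ 2)%:E <= V%:E)%E ->
  28 * Num.sqrt V <= v ->
  (P [set w | (v <= `|Y w - c|)%R] <= (2 * expR (- (v ^+ 2 / (144 * V))))%:E)%E.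
Proof.
move=> mY [m [s [s0 YL]]] V0 YV vV.
pose sd := Num.sqrt V; have sd0 : 0 < sd by rewrite sqrtr_gt0.
have sdV : sd ^+ 2 = V by rewrite sqr_sqrtr// ltW.
have v0 : 0 < v by apply: lt_le_trans vV; rewrite mulr_gt0.
have law (e x : R) : P [set w | (e <= `|Y w - x|)%R] =
    if s == 0 then \d_m [set y | e <= `|y - x|]
    else normal_prob m s [set y | e <= `|y - x|].
  exact: (YL [set y | e <= `|y - x|] (measurable_dist_ge _ _)).
have cheb (e : R) : 0 < e -> (P [set w | (e <= `|Y w - c|)%R] <= (V / e ^+ 2)%:E)%E.
  by move=> e0; exact: chebyshev_center.
have cheb2 : (P [set w | (2 * sd <= `|Y w - c|)%R] <= (4^-1)%:E)%E.
  have := cheb (2 * sd) (mulr_gt0 (ltr0Sn _ _) sd0).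
  rewrite (_ : V / _ = 4^-1)// exprMn sdV; field.
  by rewrite gt_eqF.
have [s00|sn0] := eqVneq s 0.
  have := cheb2; rewrite !law s00 eqxx !diracE.
  have [_|Hm _] := boolP (m \in [set y | 2 * sd <= `|y - c|]).
    by rewrite lee_fin /= => H; exfalso; move: H; lra.
  rewrite (_ : (m \in _) = false) ?lee_fin ?mulr_ge0 ?expR_ge0//.
  apply: contraNF Hm; rewrite !inE /=; apply: le_trans.
  by move: vV; rewrite -/sd; lra.
have sp : 0 < s by rewrite lt_neqAle eq_sym sn0.
have lawn (e x : R) : P [set w | (e <= `|Y w - x|)%R] =
    normal_prob m s [set y | e <= `|y - x|] by rewrite law (negbTE sn0).
have s3 : s <= 3 * sd.
  have := le_trans (normal_prob_near m c sp) _ .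
  have := cheb (s / 2) (divr_gt0 sp (ltr0Sn _ _)); rewrite lawn => H1 /(_ _ H1).
  rewrite lee_fin exprMn => H.
  rewrite -(ler_pXn2r (n := 2)) ?nnegrE ?mulr_ge0 ?(ltW sd0)//.
  rewrite exprMn sdV.
  move: H; rewrite ler_pdivlMr ?mulr_gt0 ?exprn_gt0//.
  rewrite exprVn; lra.
have mc : `|m - c| <= 14 * sd.
  rewrite leNgt; apply/negP => far.
  have t4 := normal_prob_tail m sp (mulr_ge0 (ler0n _ 4) (ltW sp)).
  rewrite -lawn in t4.
  have mset (x e : R) : measurable [set w | (e <= `|Y w - x|)%R].
    rewrite (_ : [set w | _] = Y @^-1` [set y | e <= `|y - x|])//.
    by rewrite -[X in measurable X]setTI; apply: mY => //; exact: measurable_dist_ge.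
  have : (1 <= P ([set w | (2 * sd <= `|Y w - c|)%R] `|`
    [set w | (4%:R * s <= `|Y w - m|)%R]))%E.
    rewrite -(probability_setT P) le_measure ?inE//; first exact: measurableU.
    move=> w _ /=; have [|near] := leP (2 * sd) `|Y w - c|; [by left|right].
    have := ler_distD (Y w) m c; rewrite (distrC m (Y w)).
    lra.
  apply/negP; rewrite -ltNge.
  apply: le_lt_trans (measureU2 _ _ _) _ => //.
  apply: le_lt_trans (leeD cheb2 t4) _.
  rewrite -EFinD lte_fin.
  rewrite (_ : (4%:R * s) ^+ 2 / (4 * s ^+ 2) = 4); last by field; rewrite gt_eqF.
  have e4 : expR (- 4) <= 5^-1 :> R.
    rewrite expRN lef_pV2 ?posrE ?expR_gt0//.
    by apply: le_trans (expR_ge1Dx 4); lra.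
  lra.
apply: (@le_trans _ _ (P [set w | (v / 2 <= `|Y w - m|)%R])).
  have mset (x e : R) : measurable [set w | (e <= `|Y w - x|)%R].
    rewrite (_ : [set w | _] = Y @^-1` [set y | e <= `|y - x|])//.
    by rewrite -[X in measurable X]setTI; apply: mY => //; exact: measurable_dist_ge.
  rewrite le_measure ?inE// => w /= vw.
  have := ler_distD m (Y w) c; move: vV; rewrite -/sd; lra.
rewrite lawn; apply: le_trans (normal_prob_tail m sp _) _.
  by rewrite divr_ge0 ?(ltW v0).
rewrite lee_fin ler_wpM2l// ler_expR lerN2.
rewrite [leRHS](_ : _ = v ^+ 2 / (16 * s ^+ 2)); last by field; rewrite gt_eqF.
rewrite ler_pM2l ?exprn_gt0// lef_pV2 ?posrE ?mulr_gt0 ?exprn_gt0//.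
have : s ^+ 2 <= (3 * sd) ^+ 2 by rewrite lerXn2r ?nnegrE ?mulr_ge0 ?(ltW sd0) ?(ltW sp).
rewrite exprMn sdV; lra.
Qed.

End law.
End gaussian.

(** * Linear statistics of the data *)

Section linear_statistics.
Variables (R : realType) (d : measure_display) (T : measurableType d).
Variable P : probability T R.

(** The mixed products are integrable because they are dominated by the sum of
    two squares, whose integrals are the finite diagonal values of [K]. *)
Lemma second_moment_lincomb n (D : 'I_n -> T -> R) (K : 'I_n -> 'I_n -> R)
    (a : 'I_n -> R) : (forall i, measurable_fun [set: T] (D i)) ->
  (forall i j, \int[P]_w (D i w * D j w)%:E = (K i j)%:E)%E ->
  (\int[P]_w ((\sum_i a i * D i w) ^+ 2)%:E
    = (\sum_i \sum_j a i * a j * K i j)%:E)%E.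
Proof.
move=> mD DK.
have mDD i j : measurable_fun [set: T] (fun w => D i w * D j w).
  exact: measurable_funM.
have sqi i : P.-integrable [set: T] (fun w => (D i w * D i w)%:E).
  apply/integrableP; split; first exact/measurable_EFinP.
  rewrite (eq_integral (fun w => (D i w * D i w)%:E)) ?DK ?ltry// => w _ /=.
  by rewrite ger0_norm// -expr2 sqr_ge0.
have Di i j : P.-integrable [set: T] (fun w => (D i w * D j w)%:E).
  apply: (@le_integrable _ _ _ P _ _ _
    (fun w => (D i w * D i w)%:E + (D j w * D j w)%:E)%E) => //.
  - exact/measurable_EFinP.
  - move=> w _ /=; rewrite lee_fin -!expr2 normrM.
    rewrite [leRHS]ger0_norm ?addr_ge0 ?sqr_ge0//.
    rewrite -(real_normK (num_real (D i w))) -(real_normK (num_real (D j w))).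
    have := sqr_ge0 (`|D i w| - `|D j w|); have := sqr_ge0 (`|D i w| + `|D j w|).
    by nra.
  - exact: integrableD.
pose g (ij : 'I_n * 'I_n) w := ((a ij.1 * a ij.2)%:E * (D ij.1 w * D ij.2 w)%:E)%E.
have gi ij : P.-integrable [set: T] (g ij) by apply: integrableZl.
transitivity (\int[P]_w (\sum_(ij <- index_enum _) g ij w))%E.
  apply: eq_integral => w _.
  rewrite sumEFin expr2 big_distrlr pair_bigA /=; congr (_%:E).
  by apply: eq_bigr => ij _; rewrite mulrACA.
rewrite integral_sum// pair_bigA /= -sumEFin; apply: eq_bigr => ij _.
by rewrite integralZl// DK -EFinM.
Qed.

Lemma second_moment_data (nu b : R) (eta : R * R) n h (G : R -> {mfun T >-> R})
    (a : 'rV[R]_n) : data_law nu eta b n h P G ->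
  (\int[P]_w (((a *m sample n (obs G n w)) 0 0 -
     (a *m sample n (hyp_mean b h)) 0 0) ^+ 2)%:E
  = (qform (cov_mx nu eta n) a)%:E)%E.
Proof.
move=> [_ cov mean].
pose D (i : 'I_n) w := G (i.+1%:R / n%:R) w - hyp_mean b h i.+1.
rewrite qformE.
have t01 (i : 'I_n) : 0 <= (i.+1%:R / n%:R : R) <= 1.
  have n0 : (0 < n)%N by case: i => i; apply: leq_ltn_trans.
  by rewrite divr_ge0//= ler_pdivrMr ?ltr0n// mul1r ler_nat ltn_ord.
rewrite -(@second_moment_lincomb n D (cov_mx nu eta n) (a 0)).
- apply: eq_integral => w _; congr ((_ ^+ 2)%:E).
  rewrite !mxE -sumrB; apply: eq_bigr => i _.
  by rewrite !mxE /D /obs mulrBr.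
- by move=> i; apply: measurable_funB.
move=> i j; rewrite mxE.
have := cov _ _ (t01 i) (t01 j).
rewrite unlock !mean ?ltn_ord// /= => C.
by rewrite /matern_cov mulrBl -C unlock.
Qed.

Lemma gaussian_law_data (nu b : R) (eta : R * R) n h (G : R -> {mfun T >-> R})
    (a : 'rV[R]_n) : data_law nu eta b n h P G ->
  gaussian_law P (fun w => (a *m sample n (obs G n w)) 0 0).
Proof.
move=> [gauss _ _].
have := gauss n (fun i => i.+1%:R / n%:R) (a 0) _.
rewrite (_ : (fun w => (_ *m _) 0 0) =
  (fun w => \sum_(i < n) a 0 i * G (i.+1%:R / n%:R) w)).
  apply=> i.
  have n0 : (0 < n)%N by case: i => i; apply: leq_ltn_trans.
  by rewrite divr_ge0//= ler_pdivrMr ?ltr0n// mul1r ler_nat ltn_ord.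
by apply/funext => w; rewrite mxE; apply: eq_bigr => i _; rewrite mxE.
Qed.

Lemma measurable_data n (G : R -> {mfun T >-> R}) (a : 'rV[R]_n) :
  measurable_fun [set: T] (fun w => (a *m sample n (obs G n w)) 0 0).
Proof.
rewrite (_ : (fun w => _) =
  (fun w => \sum_(i < n) a 0 i * G (i.+1%:R / n%:R) w)).
  apply: measurable_sum => i; apply: measurable_funM => //.
by apply/funext => w; rewrite mxE; apply: eq_bigr => i _; rewrite mxE.
Qed.

Lemma linear_statistic_tail (nu b V v : R) (eta : R * R) n h
    (G : R -> {mfun T >-> R}) (a : 'rV[R]_n) :
  data_law nu eta b n h P G -> 0 < V -> qform (cov_mx nu eta n) a <= V ->
  28 * Num.sqrt V <= v ->
  (P [set w | (v <= `|(a *m sample n (obs G n w)) 0 0 -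
       (a *m sample n (hyp_mean b h)) 0 0|)%R]
    <= (2 * expR (- (v ^+ 2 / (144 * V))))%:E)%E.
Proof.
move=> law V0 aV vV; apply: gaussian_tail => //.
- exact: measurable_data.
- exact: gaussian_law_data law.
- by rewrite (second_moment_data _ law) lee_fin.
Qed.

End linear_statistics.

(** * The plug-in statistic *)

Section range_bounds.
Variables (R : realType) (Om : set (R * R)).
Hypotheses (Om_compact : compact Om) (Om_neq0 : Om !=set0).
Hypothesis Om_pos : forall eta, Om eta -> 0 < eta.1 /\ 0 < eta.2.

Lemma range_le_rho_max eta : Om eta -> eta.2 <= rho_max Om.
Proof.
have cs : {within Om, continuous (@snd R R)}.
  by apply: continuous_subspaceT => x; exact: cvg_snd.
have [c _ cmax] := compact_EVT_max Om_neq0 Om_compact cs.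
move=> etaO; apply: ub_le_sup; last by exists eta.
by exists c.2 => _ [e /mem_set eO <-]; exact: cmax.
Qed.

Lemma range_ge_pos : exists2 r : R, 0 < r & forall eta, Om eta -> r <= eta.2.
Proof.
have cs : {within Om, continuous (@snd R R)}.
  by apply: continuous_subspaceT => x; exact: cvg_snd.
have [c /set_mem cO cmin] := compact_EVT_min Om_neq0 Om_compact cs.
by exists c.2 => [|e /mem_set eO]; [have [] := Om_pos cO|exact: cmin].
Qed.

End range_bounds.

Section whitened_statistic.
Variables (R : realType) (nu rho : R).
Hypotheses (nu0 : 0 < nu) (rho0 : 0 < rho).

Let M n := cov_mx nu (1, rho) n.

Definition signal_energy n t : R :=
  ((sample n (zeta R t))^T *m invmx (M n) *m sample n (zeta R t)) 0 0.

(** Weights of the studentized statistic for the change point [t], computed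
    with unit scale. *)
Definition glrt_weight n t : 'rV[R]_n :=
  (Num.sqrt (signal_energy n t))^-1 *: ((sample n (zeta R t))^T *m invmx (M n)).

(** The case [s = 0] is covered by the conventions that a singular matrix is its
    own inverse and that [0^-1 = 0]. *)
Lemma invmx_cov s n : invmx (cov_mx nu (s, rho) n) = (s ^+ 2)^-1 *: invmx (M n).
Proof.
rewrite cov_mx_scale//; have [->|s0] := eqVneq s 0.
  rewrite expr0n/= invr0 !scale0r; case: n => [|n].
    by rewrite [LHS]thinmx0 [RHS]thinmx0.
  by rewrite invmx_out// inE /= unitmxE det0 unitr0.
by rewrite invmxZ// unitmxZ ?unitfE ?expf_neq0// cov_mx_unit//= ltr01.
Qed.

Lemma qform_invmx n (z : 'cV[R]_n) :
  qform (M n) (z^T *m invmx (M n)) = (z^T *m invmx (M n) *m z) 0 0.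
Proof.
rewrite /qform mulmxKV ?cov_mx_unit//= trmx_mul trmxK trmx_inv /M cov_mx_sym.
by rewrite mulmxA.
Qed.

Lemma signal_energy_ge0 n t : 0 <= signal_energy n t.
Proof. by rewrite /signal_energy -qform_invmx qform_cov_ge0. Qed.

Lemma glrt_termE s n t (x : nat -> R) :
  let z := sample n (zeta R t) in
  `|(z^T *m invmx (cov_mx nu (s, rho) n) *m sample n x) 0 0 /
    Num.sqrt ((z^T *m invmx (cov_mx nu (s, rho) n) *m z) 0 0)| ^+ 2 =
  (s ^+ 2)^-1 * ((glrt_weight n t *m sample n x) 0 0) ^+ 2.
Proof.
have scE c (A : 'M[R]_1) : (c *: A) 0 0 = c * A 0 0 by rewrite mxE.
rewrite /= invmx_cov -!scalemxAr -!scalemxAl !scE real_normK ?num_real//.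
have v0 := signal_energy_ge0 n t.
rewrite ?/glrt_weight -?scalemxAl ?scE !exprMn !exprVn.
rewrite -/(signal_energy n t) !sqr_sqrtr// ?mulr_ge0 ?invr_ge0 ?sqr_ge0//.
move: (_ 0 0) (signal_energy n t) => y v.
have [->|s0] := eqVneq s 0; first by rewrite !expr0n/= !invr0 !mul0r.
rewrite [(_ * v)^-1]invfM invrK; move: v^-1 => u.
by field.
Qed.

(** The estimated scale enters the test as a rescaling of the threshold, except
    that a zero estimate never rejects. *)
Lemma glrtE s n (C : pred nat) thr (x : nat -> R) : 0 < thr ->
  glrt nu (s, rho) n C thr x =
  [exists t : 'I_n.+1, [&& C t, s != 0 &
     thr * s ^+ 2 <= ((glrt_weight n t *m sample n x) 0 0) ^+ 2]].
Proof.
move=> thr0; rewrite /glrt.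
have E (t : 'I_n.+1) : (thr <= (s ^+ 2)^-1 * ((glrt_weight n t *m sample n x) 0 0) ^+ 2) =
    (s != 0) && (thr * s ^+ 2 <= ((glrt_weight n t *m sample n x) 0 0) ^+ 2).
  have [->|s0] /= := eqVneq s 0.
    by rewrite expr0n/= invr0 mul0r leNgt thr0.
  by rewrite mulrC ler_pdivlMr// exprn_even_gt0.
apply/bigmax_geP/existsP => [[|[t Ct]]|[t /andP[Ct H]]].
- by rewrite leNgt thr0.
- by rewrite glrt_termE E => H; exists t; rewrite Ct.
- by right; exists t => //; rewrite glrt_termE E.
Qed.

(** The right-hand side is the square of the scale that matches the
    microergodic parameter of [eta] at the range [rho]; at that pair the variance
    of the studentized statistic is exactly this square. *)
Lemma qform_glrt_weight_le eta n t : 0 < eta.2 -> eta.2 <= rho ->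
  0 < signal_energy n t ->
  qform (cov_mx nu eta n) (glrt_weight n t) <=
    (eta.1 * eta.2 `^ (- nu) * rho `^ nu) ^+ 2.
Proof.
move=> e0 er v0; set s := _ * _ * _.
apply: (@le_trans _ _ (qform (cov_mx nu (s, rho) n) (glrt_weight n t))).
  apply: qform_cov_le => //; rewrite /microergodic /s /= !exprMn -!(powR_mulrn _ (powR_ge0 _ _)).
  rewrite -!powRrM -[RHS]mulrA -powRD ?(gt_eqF rho0) ?implybT//.
  rewrite (_ : nu * 2%:R + - (2 * nu) = 0) ?powRr0 ?mulr1; last by ring.
  by congr (_ * _ `^ _); ring.
rewrite cov_mx_scale// /qform -scalemxAr -scalemxAl mxE -/(qform _ _).
rewrite ler_piMr ?sqr_ge0// /glrt_weight /qform linearZ /=.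
rewrite -!scalemxAl -!scalemxAr scalerA mxE -/(qform _ _) qform_invmx.
rewrite -/(signal_energy n t) -invfM -expr2 sqr_sqrtr ?(ltW v0)//.
by rewrite mulVf// gt_eqF.
Qed.

Lemma glrt_weight_zeta n t : 
  (glrt_weight n t *m sample n (zeta R t)) 0 0 = Num.sqrt (signal_energy n t).
Proof.
rewrite /glrt_weight -scalemxAl mxE -/(signal_energy n t).
have v0 := signal_energy_ge0 n t.
rewrite -{2}(sqr_sqrtr v0) expr2.
have [->|s0] := eqVneq (Num.sqrt (signal_energy n t)) 0; first by rewrite !mulr0.
by rewrite mulrA mulVf ?mul1r.
Qed.

(** The finite-difference stencil straddling the change point is a competitor
    for the signal-to-noise ratio, which [zeta^T M^-1 zeta] maximizes. *)
Lemma signal_energy_ge : exists (c : R) (p : nat), 0 < c /\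
  forall n t, (0 < t)%N -> (t + p <= n)%N ->
    c * n%:R `^ (2 * nu) <= signal_energy n t.
Proof.
pose p := (Num.truncn (nu + 1)).+1.
pose B := (2 * pi)^-1 * (2 * (matern_amp nu * microergodic nu (1, rho) *
     (1 + 4 ^+ p / (2 * nu)))).
have B0 : 0 < B.
  have K0 : 0 < matern_amp nu * microergodic nu (1, rho).
    apply: mulr_gt0; first exact: matern_amp_gt0.
    by rewrite /microergodic /= expr1n mul1r powR_gt0.
  have pi2 : 0 < (2 * pi)^-1 :> R by rewrite invr_gt0 mulr_gt0// pi_gt0.
  rewrite /B; move: (_ * microergodic _ _) K0 => K K0.
  apply: mulr_gt0 => //; rewrite mulr_gt0// mulr_gt0// addr_gt0//.
  by rewrite divr_gt0 ?exprn_gt0 ?mulr_gt0.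
exists (4 / B), p; split; first by rewrite divr_gt0.
move=> n t t0 tpn.
have n0 : 0 < n%:R :> R by rewrite ltr0n (leq_trans _ tpn)// addn_gt0 t0.
have pnu : 2 * nu + 1 <= (2 * p)%:R.
  have : nu + 1 <= p%:R by rewrite ltW// truncnS_gt.
  rewrite natrM; lra.
have qle := @qform_stencil_le R nu nu0 (1, rho) p t n rho0 pnu t0 tpn.
have a0 : poly_rV (stencil R p t) != 0 :> 'rV_n.
  apply/eqP => a0; have := @stencil_zeta R p t n isT t0 tpn.
  by rewrite a0 mul0mx mxE => /eqP; rewrite eq_sym oppr_eq0 pnatr_eq0.
have := @whitened_sqr_ge R n (M n) (poly_rV (stencil R p t)) (sample n (zeta R t)).
rewrite stencil_zeta// -/(signal_energy n t) sqrrN => /(_ (cov_mx_sym _ _ _)).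
move=> /(_ (@cov_mx_unit R nu nu0 (1, rho) n ltr01 rho0)) /(_ (fun y => @qform_cov_ge0 R nu nu0 (1, rho) n y rho0)).
move=> /(_ (@qform_cov_gt0 R nu nu0 (1, rho) n _ ltr01 rho0 a0)) H.
have := le_trans H (ler_wpM2r (signal_energy_ge0 n t) qle).
rewrite -/B powRN => {}H.
have nu2 : 0 < n%:R `^ (2 * nu) by rewrite powR_gt0.
move: H; rewrite mulrAC ler_pdivlMr// => H.
rewrite mulrAC ler_pdivrMr// mulrC [leRHS]mulrC; apply: le_trans H.
by rewrite mulrC; lra.
Qed.

End whitened_statistic.

(** * Error probabilities *)

Section error_probabilities.
Variables (R : realType) (nu alpha : R) (rho : R).
Hypotheses (nu0 : 0 < nu) (rho0 : 0 < rho).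
Variable sigma_hat : forall n, (burnin_size alpha n).-tuple R -> R.
Hypothesis sigma_hat_meas : forall n, measurable_fun setT (@sigma_hat n).
Variables (d : measure_display) (T : measurableType d).
Variable G : R -> {mfun T >-> R}.
Variable eta : R * R.
Hypotheses (eta1 : 0 < eta.1) (eta2 : 0 < eta.2) (eta_rho : eta.2 <= rho).

Definition scale_estimate n (w : T) : R :=
  sigma_hat (burnin alpha n (obs G n w)).

Lemma measurable_scale_estimate n : measurable_fun [set: T] (scale_estimate n).
Proof.
apply: (measurableT_comp (@sigma_hat_meas n)).
apply/measurable_fun_tnthP => i.
rewrite (_ : _ \o _ = fun w => G (i.+1%:R / n%:R) w)//.
by apply/funext => w /=; rewrite tnth_mktuple.
Qed.

Definition statistic n t (w : T) : R :=
  (glrt_weight nu rho n t *m sample n (obs G n w)) 0 0.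

Lemma measurable_statistic n t : measurable_fun [set: T] (statistic n t).
Proof. exact: measurable_data. Qed.

Let k : R := eta.1 * eta.2 `^ (- nu).
Let k0 : 0 < k. Proof. by rewrite /k mulr_gt0 ?powR_gt0. Qed.

Definition bad_event n : set T := [set w | k / 2 <
  `|k - scale_estimate n w * rho `^ (- nu)|].

Lemma measurable_bad_event n : measurable (bad_event n).
Proof.
rewrite (_ : bad_event n = (fun w => `|k - scale_estimate n w * rho `^ (- nu)|)
   @^-1` `]k / 2, +oo[%classic); last first.
  by apply/seteqP; split => w /=; rewrite in_itv/= andbT.
rewrite -[X in measurable X]setTI.
suff mf : measurable_fun [set: T]
    (fun w => `|k - scale_estimate n w * rho `^ (- nu)|) by exact: mf.
apply: measurableT_comp => //; apply: measurable_funB => //.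
apply: measurable_funM => //; exact: measurable_scale_estimate.
Qed.

(** The scale which, combined with the range [rho], has the same microergodic
    parameter as [eta]. *)
Definition matched_scale : R := k * rho `^ nu.

Lemma matched_scale_gt0 : 0 < matched_scale.
Proof. by rewrite mulr_gt0 ?powR_gt0. Qed.

Lemma not_bad n w : ~ bad_event n w ->
  matched_scale / 2 <= scale_estimate n w <= 3 / 2 * matched_scale.
Proof.
move=> /negP; rewrite -leNgt powRN.
have r0 : 0 < rho `^ nu by rewrite powR_gt0.
rewrite /matched_scale; move: (rho `^ nu) r0 (scale_estimate n w) => r r0 s.
rewrite ler_distl => /andP[h1 h2].
have E : s = (s * r^-1) * r by rewrite divfK// gt_eqF.
have u1 : k / 2 <= s / r by lra.
have u2 : s / r <= 3 / 2 * k by lra.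
apply/andP; split.
  by rewrite E mulrAC ler_wpM2r ?(ltW r0).
by rewrite E mulrA ler_wpM2r ?(ltW r0).
Qed.

Lemma test_eventE n (C : pred nat) thr : 0 < thr ->
  [set w | glrt nu (scale_estimate n w, rho) n C thr (obs G n w)] =
  \big[setU/set0]_(t < n.+1 | C t)
    [set w | scale_estimate n w != 0 /\
      thr * scale_estimate n w ^+ 2 <= statistic n t w ^+ 2].
Proof.
move=> thr0; rewrite -bigcup_seq_cond.
apply/seteqP; split => w /=.
  rewrite glrtE// => /existsP[t /and3P[Ct s0 H]].
  by exists t => //=; rewrite mem_index_enum.
move=> [t /=]; rewrite mem_index_enum /= => Ct [s0 H].
by rewrite glrtE//; apply/existsP; exists t; rewrite Ct s0.
Qed.

Lemma measurable_test_event n (C : pred nat) thr : 0 < thr ->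
  measurable [set w | glrt nu (scale_estimate n w, rho) n C thr (obs G n w)].
Proof.
move=> thr0; rewrite test_eventE//; apply: bigsetU_measurable => t _.
have ms := measurable_scale_estimate n.
have mY := measurable_statistic n t.
rewrite (_ : [set w | _] = [set w | scale_estimate n w != 0] `&`
  [set w | thr * scale_estimate n w ^+ 2 <= statistic n t w ^+ 2])//.
apply: measurableI.
  rewrite (_ : [set w | scale_estimate n w != 0] = scale_estimate n @^-1` (~` [set 0])).
    rewrite -[X in measurable X]setTI; apply: ms => //.
    by apply: measurableC; exact: measurable_set1.
  by apply/seteqP; split => w /= /eqP.
rewrite -[X in measurable X]setTI; apply: measurable_fun_le => //.
  by apply: measurable_funM => //; exact: measurable_funX.
exact: measurable_funX.
Qed.

Section laws.
Variables (P : probability T R) (b thr : R) (n : nat).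
Hypothesis thr_ge : 56 ^+ 2 <= thr.

Let V : R := matched_scale ^+ 2.
Let v : R := Num.sqrt thr * matched_scale / 2.

Let V0 : 0 < V. Proof. by rewrite exprn_gt0// matched_scale_gt0. Qed.
Let thr0 : 0 < thr. Proof. by apply: lt_le_trans thr_ge; rewrite exprn_gt0. Qed.

Let sqrt_thr : 56 <= Num.sqrt thr.
Proof.
by rewrite -[56]ger0_norm// -sqrtr_sqr ler_sqrt ?(ltW thr0).
Qed.

(** The level [v] is both the smallest value that a false alarm gives to
    [|Y_t|] when the scale estimate is at least [matched_scale / 2], and the
    margin left to a detected mean when that estimate is at most
    [3 / 2 * matched_scale]. *)
Lemma statistic_tail h t : data_law nu eta b n h P G ->
  0 < signal_energy nu rho n t ->
  (P [set w | (v <= `|statistic n t w -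
     (glrt_weight nu rho n t *m sample n (hyp_mean b h)) 0 0|)%R]
    <= (2 * expR (- (thr / (4 * 144))))%:E)%E.
Proof.
move=> law e0.
have s0 := matched_scale_gt0.
have := @linear_statistic_tail _ _ _ P nu b V v eta n h G _ law V0
  (qform_glrt_weight_le nu0 rho0 eta2 eta_rho e0).
rewrite (_ : v ^+ 2 / (144 * V) = thr / (4 * 144)); last first.
  rewrite /v /V; move: matched_scale s0 => s s0.
  by rewrite !exprMn sqr_sqrtr ?(ltW thr0)// exprVn; field; rewrite gt_eqF.
apply.
rewrite /V sqrtr_sqr gtr0_norm// /v; move: s0 sqrt_thr.
move: (Num.sqrt thr) matched_scale => x s; nra.
Qed.

Let measurable_tail t (c : R) : measurable [set w | v <= `|statistic n t w - c|].
Proof.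
rewrite (_ : [set w | _] = statistic n t @^-1` [set x | v <= `|x - c|])//.
rewrite -[X in measurable X]setTI; apply: measurable_statistic => //.
exact: measurable_dist_ge.
Qed.

Lemma false_alarm_le (C : pred nat) : data_law nu eta b n H0 P G ->
  (forall t, C t -> 0 < signal_energy nu rho n t) ->
  fine (P [set w | glrt nu (scale_estimate n w, rho) n C thr (obs G n w)])
  <= fine (P (bad_event n)) + n.+1%:R * (2 * expR (- (thr / (4 * 144)))).
Proof.
move=> law Ce.
pose B t := if C t then [set w | v <= `|statistic n t w - 0|] else set0.
have mB t : measurable (B t) by rewrite /B; case: ifP.
have mbad := measurable_bad_event n.
have mE := measurable_test_event n C thr0.
have sub : [set w | glrt nu (scale_estimate n w, rho) n C thr (obs G n w)]
    `<=` bad_event n `|` \big[setU/set0]_(t < n.+1) B t.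
  move=> w; rewrite test_eventE// -bigcup_seq_cond => -[t /=].
  rewrite mem_index_enum /= => Ct [s0 H].
  have [wb|wb] := pselect (bad_event n w); [by left|right].
  rewrite -bigcup_mkord; exists t => //=; rewrite /B Ct /= subr0.
  have /andP[s1 _] := not_bad wb.
  rewrite -(ler_pXn2r (n := 2)) ?nnegrE//; last first.
    by rewrite /v divr_ge0// mulr_ge0 ?sqrtr_ge0// ltW// matched_scale_gt0.
  rewrite real_normK ?num_real//; apply: le_trans H.
  rewrite /v -mulrA exprMn sqr_sqrtr ?(ltW thr0)// ler_wpM2l ?(ltW thr0)//.
  have s2 : 0 <= matched_scale / 2 by rewrite divr_ge0// ltW// matched_scale_gt0.
  by rewrite lerXn2r ?nnegrE// (le_trans s2).
rewrite -lee_fin EFinD !fineK ?fin_num_measure//.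
apply: (le_trans (le_measure _ _ _ sub)); rewrite ?inE//.
  by apply: measurableU => //; exact: bigsetU_measurable.
apply: (le_trans (measureU2 _ _ _)) => //; first exact: bigsetU_measurable.
apply: leeD => //.
apply: (le_trans (Boole_inequality _ _)) => //.
apply: (@le_trans _ _ (\sum_(i < n.+1) (2 * expR (- (thr / (4 * 144))))%:E)%E).
  apply: lee_sum => t _; rewrite /B; case: ifPn => Ct.
    have := statistic_tail law (Ce _ Ct).
    rewrite (_ : (_ *m sample n (hyp_mean b H0)) 0 0 = 0)//.
    by rewrite mxE big1// => i _; rewrite !mxE mulr0.
  by rewrite measure0 lee_fin mulr_ge0 ?expR_ge0.
by rewrite sumEFin lee_fin sumr_const card_ord [leRHS]mulr_natl.
Qed.

(** Outside of [bad_event], missing the change forces [|Y_t| <= 3 v], whereas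
    the mean of [Y_t] is at least [4 v] in absolute value. *)
Lemma missed_detection_le (C : pred nat) (t : 'I_n.+1) :
  data_law nu eta b n (H1 t) P G -> C t ->
  0 < signal_energy nu rho n t ->
  4 * (Num.sqrt thr * matched_scale) <= `|b| * Num.sqrt (signal_energy nu rho n t) ->
  fine (P [set w | ~~ glrt nu (scale_estimate n w, rho) n C thr (obs G n w)])
  <= fine (P (bad_event n)) + 2 * expR (- (thr / (4 * 144))).
Proof.
move=> law Ct e0 bb.
pose c : R := (glrt_weight nu rho n t *m sample n (hyp_mean b (H1 t))) 0 0.
have cE : c = b / 2 * Num.sqrt (signal_energy nu rho n t).
  rewrite -glrt_weight_zeta// /c.
  rewrite (_ : sample n (hyp_mean b (H1 t)) = (b / 2) *: sample n (zeta R t)).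
    by rewrite -scalemxAr mxE.
  by apply/matrixP => i j; rewrite !mxE.
have mbad := measurable_bad_event n.
have mE := measurable_test_event n C thr0.
have mtail := measurable_tail t c.
have sub : [set w | ~~ glrt nu (scale_estimate n w, rho) n C thr (obs G n w)]
    `<=` bad_event n `|` [set w | v <= `|statistic n t w - c|].
  move=> w /= nt.
  have [wb|wb] := pselect (bad_event n w); [by left|right] => /=.
  have /andP[s1 s2] := not_bad wb.
  have m0 := matched_scale_gt0.
  have s0 : 0 < scale_estimate n w by apply: lt_le_trans s1; rewrite divr_gt0.
  have lt1 : statistic n t w ^+ 2 < thr * scale_estimate n w ^+ 2.
    rewrite ltNge; apply: contra nt => H; rewrite glrtE//; apply/existsP.
    by exists t; rewrite Ct gt_eqF.
  have lt2 : `|statistic n t w| <= 3 * v.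
    have v0 : 0 <= 3 * v.
      apply: mulr_ge0 => //; apply: divr_ge0 => //.
      by apply: mulr_ge0; [exact: sqrtr_ge0|exact: ltW].
    rewrite -(ler_pXn2r (n := 2)) ?nnegrE//.
    rewrite real_normK ?num_real//; apply: (le_trans (ltW lt1)).
    rewrite (_ : 3 * v = Num.sqrt thr * (3 / 2 * matched_scale)); last first.
      by rewrite /v; field.
    rewrite [leRHS]exprMn sqr_sqrtr ?(ltW thr0)// ler_wpM2l ?(ltW thr0)//.
    by rewrite lerXn2r ?nnegrE ?(ltW s0)// (le_trans (ltW s0)).
  have cb : 4 * v <= `|c|.
    rewrite cE normrM normrM (ger0_norm (sqrtr_ge0 _)) normfV (ger0_norm (ler0n _ 2)).
    rewrite /v; move: bb; lra.
  have := lerB_dist c (statistic n t w); rewrite (distrC c); lra.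
rewrite -lee_fin EFinD !fineK ?fin_num_measure//; last first.
  by rewrite (_ : [set w | ~~ _] = ~` [set w | glrt nu (scale_estimate n w, rho) n C thr (obs G n w)]);
    [exact: measurableC|apply/seteqP; split => w /= /negP].
apply: (le_trans (le_measure _ _ _ sub)); rewrite ?inE//.
- rewrite (_ : [set w | ~~ _] = ~` [set w | glrt nu (scale_estimate n w, rho) n C thr (obs G n w)]);
    [exact: measurableC|by apply/seteqP; split => w /= /negP].
- exact: measurableU.
apply: (le_trans (measureU2 _ _ _)) => //.
by apply: leeD => //; exact: statistic_tail.
Qed.

End laws.
End error_probabilities.

(** * Uniform consistency and the risk bound *)

Section tail_supremum.
Variable R : realType.

(** Several sample sizes share the same burn-in size [m], all of them at least
    [m]; the supremum over the tail is a bound that depends on [m] only. *)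
Lemma tail_sup (q : nat -> R) : (forall n, 0 <= q n <= 1) ->
  q @ \oo --> (0 : R) ->
  exists tau : nat -> R, [/\ forall m, 0 <= tau m, tau @ \oo --> (0 : R) &
    forall m n, (m <= n)%N -> q n <= tau m].
Proof.
move=> q01 q0.
pose S m := [set q n | n in [set n | (m <= n)%N]].
have ubS m : has_ubound (S m) by exists 1 => _ [n _ <-]; have /andP[] := q01 n.
have le_tau m n : (m <= n)%N -> q n <= sup (S m).
  by move=> mn; apply: ub_le_sup => //; exists n.
have tau0 m : 0 <= sup (S m).
  by apply: le_trans (le_tau _ _ (leqnn m)); have /andP[] := q01 m.
exists (fun m => sup (S m)); split => //.
apply/cvgrPdist_le => e e0.
have /cvgrPdist_le/(_ e e0)[N _ HN] := q0.
exists N => // m /= Nm; rewrite sub0r normrN ger0_norm//.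
apply: ge_sup; first by exists (q m), m => /=.
move=> _ [n /= mn <-]; have := HN n (leq_trans Nm mn).
by rewrite sub0r normrN; apply: le_trans; exact: ler_norm.
Qed.

End tail_supremum.

Section consistency.
Variables (R : realType) (d : measure_display) (T : measurableType d).
Variables (CP : nat -> pred nat) (P : nat -> hypothesis -> probability T R).
Variable bad : nat -> set T.
Hypothesis mbad : forall n, measurable (bad n).

(** At each sample size, select a hypothesis whose error probability is within
    [1 / (n + 1)] of the supremum; convergence along this selection is
    convergence of the suprema. *)
Lemma uniform_over_hypotheses :
  (forall h, (forall n, admissible CP n (h n)) ->
     (fun n => P n (h n) (bad n)) @ \oo --> 0%E) ->
  exists q : nat -> R, [/\ forall n, 0 <= q n <= 1, q @ \oo --> (0 : R) &
    forall n h, admissible CP n h -> fine (P n h (bad n)) <= q n].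
Proof.
move=> cons.
pose S n := [set fine (P n h (bad n)) | h in [set h | admissible CP n h]].
have p01 n h : 0 <= fine (P n h (bad n)) <= 1.
  rewrite fine_ge0//= -lee_fin fineK ?probability_le1//.
  exact: fin_num_measure.
have ubS n : ubound (S n) 1 by move=> _ [h _ <-]; have /andP[] := p01 n h.
have neS n : S n !=set0 by exists (fine (P n H0 (bad n))), H0.
have hsS n : has_sup (S n) by split => //; exists 1.
have le_q n h : admissible CP n h -> fine (P n h (bad n)) <= sup (S n).
  by move=> hn; apply: ub_le_sup; [exists 1|exists h].
have q01 n : 0 <= sup (S n) <= 1.
  rewrite ge_sup// andbT; apply: le_trans (le_q n H0 I).
  by have /andP[] := p01 n H0.
exists (fun n => sup (S n)); split => //.
have near_sup n : exists h, admissible CP n h /\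
    sup (S n) - n.+1%:R^-1 < fine (P n h (bad n)).
  have n0 : 0 < n.+1%:R^-1 :> R by rewrite invr_gt0.
  by have [_ [h hn <-] ?] := sup_adherent n0 (hsS n); exists h.
have [h hP] := choice near_sup.
have [_ H] := (fine_cvgP _ _).1 (cons h (fun n => (hP n).1)).
have H' : (fun n => fine (P n (h n) (bad n)) + n.+1%:R^-1) @ \oo --> (0 : R).
  by rewrite -[0]addr0; apply: cvgD H _; exact: cvg_harmonic.
apply: (squeeze_cvgr _ (cvg_cst (0 : R)) H').
apply: nearW => n; have /andP[-> _] := q01 n; rewrite /=.
by rewrite -lerBlDr ltW//; case: (hP n).
Qed.

End consistency.

Theorem theorem4p1 (R : realType) (nu alpha delta : R) (Om : set (R * R))
    (CP : nat -> pred nat)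
    (sigma_hat : forall n, (burnin_size alpha n).-tuple R -> R)
    (nu_gt0 : 0 < nu) (alpha_itv : 0 < alpha < 2^-1)
    (delta_itv : 0 < delta < 1)
    (Om_compact : compact Om)
    (Om_pos : forall eta, Om eta -> 0 < eta.1 /\ 0 < eta.2)
    (CP_range : forall n t, CP n t ->
       alpha * n%:R <= t%:R <= (1 - alpha) * n%:R)
    (sigma_hat_meas : forall n, measurable_fun setT (sigma_hat n)) :
  exists (C : R) (n0 : nat) (thr : nat -> R),
    (forall n, 0 < thr n) /\
    forall (eta : R * R) (b : nat -> R) (d : measure_display)
      (T : measurableType d) (G : R -> {mfun T >-> R})
      (P : nat -> hypothesis -> probability T R),
    Om eta ->
    (forall n, b n != 0) ->
    (forall n h, admissible CP n h -> data_law nu eta (b n) n h (P n h) G) ->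
    consistent nu Om CP sigma_hat eta P G ->
    exists tau : nat -> R,
      [/\ forall m, 0 <= tau m,
          tau @ \oo --> (0 : R) &
          forall n, (n0 <= n)%N ->
            C * n%:R `^ (- nu) *
              Num.sqrt (C_K nu eta * (1 + nu^-1) *
                        ln (n%:R * (1 - 2 * alpha) / delta)) <= `|b n| ->
            risk CP P G n (plugin_glrt nu Om CP sigma_hat thr n)
              <= delta + 2 * tau (burnin_size alpha n)].
Proof.
have [Om0|Om0] := pselect (Om !=set0); last first.
  exists 0, 0%N, (fun=> 1); split => // eta b d T G P etaO.
  by case: Om0; exists eta.
have [rmin rmin0 rminP] := range_ge_pos Om_compact Om0 Om_pos.
set rho := rho_max Om.
have rhoP eta : Om eta -> eta.2 <= rho by exact: range_le_rho_max.
have rho0 : 0 < rho.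
  have [eta etaO] := Om0; apply: lt_le_trans (rhoP _ etaO).
  by have [] := Om_pos _ etaO.
have [c [p [c0 energyP]]] := signal_energy_ge nu_gt0 rho0.
have /andP[a0 a1] := alpha_itv; have /andP[d0 d1] := delta_itv.
have ge0 : 0 < 1 - 2 * alpha by lra.
pose L n : R := ln (n%:R * (1 - 2 * alpha) / delta).
(* [gaussian_tail] applies from 28 standard deviations on, hence the factor
   [(2 * 28)^2]; it also makes the tail bound at most
   [exp (- 2 L n)], which beats the union bound over [n + 1] terms. *)
pose thr n := 56 ^+ 2 * Num.max 1 (L n).
pose kap := matern_amp nu * rmin `^ (2 * nu + 1).
have kap0 : 0 < kap.
  by apply: mulr_gt0; [exact: matern_amp_gt0|rewrite powR_gt0].
(* [224 = 4 * 56] makes the mean of the statistic at least [4 v]. *)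
pose C := 224 * rho `^ nu / Num.sqrt (c * kap).
(* The first term makes [L n >= 1] and the union bound at most [delta / 2]; the
   second one leaves room for the stencil inside the sample. *)
pose x0 := (expR 1 + 8) / (1 - 2 * alpha) ^+ 2 + (p%:R + 1) / alpha.
have x01 : 0 <= (expR 1 + 8) / (1 - 2 * alpha) ^+ 2.
  by rewrite divr_ge0 ?addr_ge0 ?expR_ge0 ?sqr_ge0.
have x02 : 0 <= (p%:R + 1) / alpha by rewrite divr_ge0 ?addr_ge0// ltW.
have thr_ge n : 56 ^+ 2 <= thr n by rewrite /thr ler_peMr// le_max lexx.
exists C, (Num.truncn x0).+1, thr; split.
  by move=> n; apply: lt_le_trans (thr_ge n).
move=> eta b d T G P etaO _ law cons.
have [eta1 eta2] := Om_pos _ etaO.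
have eta_rho := rhoP _ etaO.
pose bad := bad_event nu rho sigma_hat G eta.
have mbad n : measurable (bad n) by apply: measurable_bad_event.
have k0 : 0 < eta.1 * eta.2 `^ (- nu) by rewrite mulr_gt0 ?powR_gt0.
have [q [q01 q0 qP]] := uniform_over_hypotheses mbad
  (fun h hP => cons h hP _ (divr_gt0 k0 (ltr0Sn _ 1))).
have [tau [tau0 taucvg tauP]] := tail_sup q01 q0.
exists tau; split => // n n0 bn.
have x0n : x0 <= n%:R.
  by rewrite (le_trans (ltW (truncnS_gt _)))// ler_nat.
have n1 : (expR 1 + 8) / (1 - 2 * alpha) ^+ 2 <= n%:R by apply: le_trans x0n; rewrite lerDl.
have n2 : (p%:R + 1) / alpha <= n%:R by apply: le_trans x0n; rewrite lerDr.
have nR : 0 < n%:R :> R by rewrite ltr0n (leq_trans _ n0).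
have mn : (burnin_size alpha n <= n)%N.
  rewrite -(ler_nat R); apply: (@le_trans _ _ (alpha * n%:R)).
    by have /andP[] := truncn_itv (mulr_ge0 (ltW a0) (ltW nR)).
  by rewrite ler_piMl ?(ltW nR)//; lra.
have qtau := tauP _ _ mn.
have CPP t : CP n t -> (0 < t)%N /\ (t + p <= n)%N.
  move=> /CP_range/andP[t1 t2].
  have pn : p%:R + 1 <= alpha * n%:R by move: n2; rewrite ler_pdivrMr// mulrC.
  split; last by rewrite -(ler_nat R) natrD; lra.
  rewrite -(ltr_nat R); apply: lt_le_trans t1; apply: lt_le_trans pn.
  by rewrite ltr_wpDl.
have e0 t : CP n t -> 0 < signal_energy nu rho n t.
  move=> /CPP[t0 tp]; apply: lt_le_trans (energyP _ _ t0 tp).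
  by rewrite mulr_gt0 ?powR_gt0.
pose y := n%:R * (1 - 2 * alpha) / delta.
have ge1 : expR 1 + 8 <= n%:R * (1 - 2 * alpha) ^+ 2.
  by move: n1; rewrite ler_pdivrMr ?exprn_gt0.
have y0 : 0 < y by rewrite divr_gt0 ?mulr_gt0.
have ye : expR 1 <= y.
  rewrite /y ler_pdivlMr//; apply: (@le_trans _ _ (expR 1)).
    by rewrite ler_piMr ?expR_ge0// ltW.
  apply: (@le_trans _ _ (n%:R * (1 - 2 * alpha) ^+ 2)).
    by apply: le_trans ge1; rewrite lerDl.
  by rewrite ler_wpM2l ?(ltW nR)// expr2 ler_piMr ?(ltW ge0)//; lra.
have L1 : 1 <= L n.
  by rewrite /L -/y -[leLHS](expRK 1) ler_ln ?posrE ?expR_gt0.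
have thrE : thr n = 56 ^+ 2 * L n by rewrite /thr max_r.
have tail : n.+1%:R * (2 * expR (- (thr n / (4 * 144)))) <= delta / 2.
  have E2 : expR (- (thr n / (4 * 144))) <= (y ^+ 2)^-1.
    rewrite -[y]lnK ?posrE// -expRM_natl -expRN ler_expR lerN2 -/(L n) thrE.
    lra.
  apply: (@le_trans _ _ (n%:R * 2 * (2 * (y ^+ 2)^-1))).
    have nge1 : 1 <= n%:R :> R by rewrite ler1n -(ltr0n R).
    apply: ler_pM.
    - exact: ler0n.
    - by apply: mulr_ge0 => //; exact: expR_ge0.
    - by rewrite -natr1; lra.
    by rewrite ler_wpM2l.
  rewrite (_ : n%:R * 2 * (2 * (y ^+ 2)^-1) =
    4 * delta ^+ 2 / (n%:R * (1 - 2 * alpha) ^+ 2)); last first.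
    by rewrite /y; field; rewrite !gt_eqF.
  have g8 : 8 <= n%:R * (1 - 2 * alpha) ^+ 2.
    by apply: le_trans ge1; rewrite lerDr expR_ge0.
  rewrite ler_pdivrMr; last by apply: lt_le_trans g8.
  apply: (@le_trans _ _ (delta / 2 * 8)); last first.
    by rewrite ler_wpM2l// divr_ge0// ltW.
  by rewrite expr2; nra.
have tail1 : 2 * expR (- (thr n / (4 * 144))) <= delta / 2.
  apply: le_trans tail; rewrite ler_peMl ?mulr_ge0 ?expR_ge0//.
  by rewrite ler1n.
have H0adm : admissible CP n H0 by [].
have fa := false_alarm_le nu_gt0 rho0 sigma_hat_meas eta1 eta2 eta_rho
  (thr_ge n) (law n H0 H0adm) e0.
have sig : forall t, CP n t -> 4 * (Num.sqrt (thr n) * matched_scale nu rho eta)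
    <= `|b n| * Num.sqrt (signal_energy nu rho n t).
  move=> t /CPP[t0 tp].
  have sth : Num.sqrt (thr n) = 56 * Num.sqrt (L n).
    by rewrite thrE sqrtrM ?exprn_ge0// sqrtr_sqr ger0_norm.
  pose k := eta.1 * eta.2 `^ (- nu).
  have CKk : kap * k ^+ 2 <= C_K nu eta.
    apply: le_trans (C_K_ge nu_gt0 eta2).
    have -> : k ^+ 2 = microergodic nu eta.
      rewrite /k /microergodic exprMn -(powR_mulrn _ (powR_ge0 _ _)) -powRrM.
      by congr (_ * _ `^ _); ring.
    rewrite /kap mulrAC ler_wpM2l ?matern_coef_ge0//.
    by rewrite ge0_ler_powR ?nnegrE ?(ltW rmin0) ?(ltW eta2) ?rminP// addr_ge0// mulr_ge0// ltW.
  have L0 : 0 <= L n by apply: le_trans L1.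
  have sCK : Num.sqrt kap * k * Num.sqrt (L n) <=
      Num.sqrt (C_K nu eta * (1 + nu^-1) * L n).
    have kk0 : 0 <= kap * k ^+ 2 by apply: mulr_ge0; [exact: ltW|exact: sqr_ge0].
    rewrite -[k]ger0_norm ?(ltW k0)// -sqrtr_sqr -sqrtrM ?(ltW kap0)//.
    rewrite -(sqrtrM _ kk0).
    apply: ler_wsqrtr; rewrite ler_wpM2r//; apply: (le_trans CKk).
    rewrite ler_peMr//; last by rewrite lerDl invr_ge0 ltW.
    exact: le_trans CKk.
  have sen : Num.sqrt c * n%:R `^ nu <= Num.sqrt (signal_energy nu rho n t).
    rewrite -[_ `^ _]ger0_norm ?powR_ge0// -sqrtr_sqr -sqrtrM ?(ltW c0)//.
    apply: ler_wsqrtr; apply: le_trans (energyP _ _ t0 tp).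
    by rewrite -(powR_mulrn _ (powR_ge0 _ _)) -powRrM [nu * _]mulrC.
  have C0 : 0 <= C by rewrite /C divr_ge0 ?mulr_ge0 ?powR_ge0 ?sqrtr_ge0.
  apply: (@le_trans _ _ ((C * n%:R `^ (- nu) * (Num.sqrt kap * k * Num.sqrt (L n)))
     * (Num.sqrt c * n%:R `^ nu))); last first.
    apply: ler_pM => //.
    - apply: mulr_ge0; first by apply: mulr_ge0 => //; exact: powR_ge0.
      apply: mulr_ge0; last exact: sqrtr_ge0.
      by apply: mulr_ge0; [exact: sqrtr_ge0|exact: ltW].
    - apply: le_trans bn; rewrite ler_wpM2l// mulr_ge0 ?powR_ge0//.
  rewrite le_eqVlt; apply/orP; left; apply/eqP.
  rewrite sth /matched_scale -/k /C (sqrtrM _ (ltW c0)) powRN.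
  have nn0 : n%:R `^ nu != 0 by rewrite gt_eqF ?powR_gt0.
  have sc0 : Num.sqrt c != 0 by rewrite gt_eqF ?sqrtr_gt0.
  have sk0 : Num.sqrt kap != 0 by rewrite gt_eqF ?sqrtr_gt0.
  move: (n%:R `^ nu) (Num.sqrt c) (Num.sqrt kap) nn0 sc0 sk0 => u1 u2 u3 *.
  by field; apply/and3P.
rewrite /risk.
apply: (@le_trans _ _ ((q n + delta / 2) + (q n + delta / 2))); last first.
  by lra.
apply: lerD.
  apply: (le_trans fa); apply: lerD => //; exact: qP.
apply/bigmax_leP; split.
  by rewrite addr_ge0 ?divr_ge0 ?(ltW d0)//; have /andP[] := q01 n.
move=> t CPt.
have := missed_detection_le nu_gt0 rho0 sigma_hat_meas eta1 eta2 eta_rho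
  (thr_ge n) (law n (H1 t) CPt) CPt (e0 _ CPt) (sig _ CPt).
move=> md; apply: (le_trans md); apply: lerD => //; exact: (qP n (H1 t)).
Qed.
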